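(* Let $n,m\in\mathbb N$, let $X\in U_{m,n}(\mathbb C)$, and consider the 2-dimensional subspace $\mathfrak m'=\mathrm{Span}_{\mathbb R}\{\hat X,\widehat{iX}\}$ of $\mathfrak m\subset\mathfrak u(n,m)$ and the natural fibration $U(n)\times U(m)\to U(n,m)\xrightarrow{\tilde\pi}D_{n,m}$. Then: (1) $\mathfrak m'$ gives rise to a complete totally geodesic surface $S$ in $D_{n,m}$. (2) $\mathfrak m'$ induces a $U(1)$-subbundle of the bundle $U(n)\times U(m)\to\tilde\pi^{-1}(S)\to S$ which is the image of an immersion, as a bundle map, $\tilde f:SU(1,1)\to U(n,m)$ of the bundle $$S(U(1)\times U(1))\to SU(1,1)\to SU(1,1)/S(U(1)\times U(1))$$ into the bundle $U(n)\times U(m)\to U(n,m)\xrightarrow{\tilde\pi}D_{n,m}$, and this $U(1)$-subbundle is isomorphic to the Hopf bundle $S^1\to S^{2,1}\to\mathbb CH^1$. (3) The immersion $\tilde f$ is conformal; in fact $|\tilde f_*v|=\sqrt n\,|v|$ for every tangent vector $v$ of $SU(1,1)$.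
   Context: Let $\Lambda^n_m=\begin{pmatrix}-I_n&0\\ 0&I_m\end{pmatrix}$ and $U(n,m)=\{\Phi\in GL_{n+m}(\mathbb C):\Phi^*\Lambda^n_m\Phi=\Lambda^n_m\}$, with Lie algebra $\mathfrak u(n,m)$. $U(n)\times U(m)\subset U(n,m)$ is the block-diagonal subgroup, and $D_{n,m}=U(n,m)/(U(n)\times U(m))$ with origin $o$ (the identity coset), regarded as an affine symmetric space; $\tilde\pi:U(n,m)\to D_{n,m}$ is the projection. Canonical decomposition: $\mathfrak u(n,m)=\mathfrak h+\mathfrak m$ with $\mathfrak h=\mathfrak u(n)+\mathfrak u(m)$ (block-diagonal) and $\mathfrak m=\{\hat X: X\in M_{m,n}(\mathbb C)\}$, where $\hat X=\begin{pmatrix}0&X^*\\ X&0\end{pmatrix}$; $\mathfrak m$ is identified with $T_oD_{n,m}$. $U_{m,n}(\mathbb C)=\{X\in M_{m,n}(\mathbb C): X^*X=\lambda I_n\text{ for some }\lambda\in\mathbb C\setminus\{0\}\}$ (then necessarily $\lambda>0$). $U(n,m)$ carries the left-invariant metric given on $\mathfrak u(n,m)$ by $\langle A,B\rangle=\tfrac12\mathrm{Re}\,\mathrm{Tr}(A^*B)$. $SU(1,1)$ carries the left-invariant metric for which $$E_1=\begin{bmatrix}0&1\\ 1&0\end{bmatrix},\quad E_2=\begin{bmatrix}0&-i\\ i&0\end{bmatrix},\quad E_3=\begin{bmatrix}-i&0\\ 0&i\end{bmatrix}$$ is an orthonormal basis of $\mathfrak{su}(1,1)$. $S(U(1)\times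 U(1))=\{\mathrm{diag}(e^{-iz},e^{iz})\}\cong S^1=U(1)$. The Hopf bundle $S^1\to S^{2,1}\to\mathbb CH^1$: $S^{2,1}=\{(z_0,z_1)\in\mathbb C^2:-|z_0|^2+|z_1|^2=-1\}$ with the scalar action of $S^1$ and quotient $\mathbb CH^1$ (isomorphism is meant as principal circle bundles, not isometrically). A linear subspace $\mathfrak m'\subset\mathfrak m$ ''gives rise to'' a complete totally geodesic submanifold $S$ if there is a complete totally geodesic submanifold of $D_{n,m}$ through $o$ with tangent space $\mathfrak m'$ at $o$; $S$ is this submanifold or a translate of it by an element of $U(n,m)$. The subbundle ''induced by $\mathfrak m'$'' means a connected integral manifold, lying over $S$, of the left-invariant distribution on $U(n,m)$ spanned by $\mathfrak m'$ and $[\mathfrak m',\mathfrak m']$. *)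

(* Defs.v *)
From HB Require Import structures.
From mathcomp Require Import all_boot all_order all_algebra.
From mathcomp Require Import all_classical all_reals all_analysis.
From mathcomp Require Import complex.

Set Implicit Arguments.
Unset Strict Implicit.
Unset Printing Implicit Defensive.

Import Order.TTheory GRing.Theory Num.Theory.
Import numFieldNormedType.Exports.

Local Open Scope classical_set_scope.
Local Open Scope complex_scope.
Local Open Scope ring_scope.
Local Open Scope sesquilinear_scope.

(* All normed spaces below are spaces of real matrices, so "C^k" has its usual
    finite-dimensional meaning.  Smoothness on an arbitrary subset means
    existence of local smooth extensions, and an embedded submanifold is a
    subset that is locally diffeomorphic to an open subset of R^k. *)

Section Smooth.
Variable R : realType.
Implicit Types E F : normedModType R.

(* Only meant for open [U]. *)
Fixpoint Ck k E F (U : set E) (f : E -> F) : Prop :=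
  match k with
  | 0%N => forall x, U x -> {for x, continuous f}
  | k'.+1 => (forall x, U x -> differentiable f x) /\
             (forall v, Ck k' U (fun x => 'D_v f x))
  end.

Definition smooth_open E F (U : set E) (f : E -> F) : Prop :=
  open U /\ forall k, Ck k U f.

Definition smooth E F (A : set E) (f : E -> F) : Prop :=
  forall x, A x -> exists (U : set E) (g : E -> F),
    [/\ smooth_open U g, U x & forall y, A y -> U y -> g y = f y].

Definition diffeo E F (A : set E) (B : set F) (f : E -> F) : Prop :=
  exists g : F -> E,
    [/\ smooth A f, smooth B g,
        forall x, A x -> B (f x) /\ g (f x) = x &
        forall y, B y -> A (g y) /\ f (g y) = y].

Definition submanifold k E (M : set E) : Prop :=
  forall p, M p -> exists (W : set E) (U : set 'rV[R]_k) (phi : 'rV[R]_k -> E),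
    [/\ open W, W p, open U & diffeo U (M `&` W) phi].

End Smooth.

(* The library has no normed space structure over [R] on matrices over
    [R[i]]; all the differential notions are transported along the real linear
    isomorphism [realmx]. *)

Section ComplexMatrices.
Variable R : realType.
Local Notation C := R[i].

Definition realmx p q (A : 'M[C]_(p, q)) : 'M[R]_(p, q + q) :=
  row_mx (map_mx (@complex.Re R) A) (map_mx (@complex.Im R) A).

Definition cplxmx p q (B : 'M[R]_(p, q + q)) : 'M[C]_(p, q) :=
  \matrix_(i, j) (lsubmx B i j +i* rsubmx B i j).

Lemma realmxK p q : cancel (@realmx p q) (@cplxmx p q).
Proof.
move=> A; apply/matrixP => i j.
by rewrite mxE row_mxKl row_mxKr !mxE; case: (A i j).
Qed.

Lemma cplxmxK p q : cancel (@cplxmx p q) (@realmx p q).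
Proof.
move=> B; rewrite -[RHS]hsubmxK; congr row_mx; apply/matrixP => i j;
  by rewrite !mxE.
Qed.

Definition cx_open p q (A : set 'M[C]_(p, q)) : Prop := open (@realmx p q @` A).

Definition cx_connected p q (A : set 'M[C]_(p, q)) : Prop :=
  connected (@realmx p q @` A).

Definition cx_smooth p q p' q' (A : set 'M[C]_(p, q))
    (f : 'M[C]_(p, q) -> 'M[C]_(p', q')) : Prop :=
  smooth (@realmx p q @` A) (fun x => realmx (f (cplxmx x))).

Definition cx_diffeo p q p' q' (A : set 'M[C]_(p, q)) (B : set 'M[C]_(p', q'))
    (f : 'M[C]_(p, q) -> 'M[C]_(p', q')) : Prop :=
  diffeo (@realmx p q @` A) (@realmx p' q' @` B) (fun x => realmx (f (cplxmx x))).

Definition cx_submanifold k p q (A : set 'M[C]_(p, q)) : Prop :=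
  submanifold k (@realmx p q @` A).

Definition smooth_curve p q (c : R -> 'M[C]_(p, q)) : Prop :=
  smooth_open (setT : set R) (fun t => realmx (c t)).

Definition has_velocity p q (c : R -> 'M[C]_(p, q)) (t : R)
    (v : 'M[C]_(p, q)) : Prop :=
  is_derive t (1 : R) (fun s => realmx (c s)) (realmx v).

Definition curve_at p q (M : set 'M[C]_(p, q)) (c : R -> 'M[C]_(p, q))
    (x v : 'M[C]_(p, q)) : Prop :=
  [/\ smooth_curve c, c 0 = x, (\forall t \near (0 : R), M (c t)) &
      has_velocity c 0 v].

Definition tangent_space p q (M : set 'M[C]_(p, q)) (x : 'M[C]_(p, q)) :
    set 'M[C]_(p, q) :=
  [set v | exists c, curve_at M c x v].

(* [w] is the image under [f_*] of the vector [v] tangent to [M] at [x]. *)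
Definition tangent_map p q p' q' (M : set 'M[C]_(p, q))
    (f : 'M[C]_(p, q) -> 'M[C]_(p', q')) x v w : Prop :=
  exists c, curve_at M c x v /\ has_velocity (fun t => f (c t)) 0 w.

Definition immersion p q p' q' (M : set 'M[C]_(p, q))
    (f : 'M[C]_(p, q) -> 'M[C]_(p', q')) : Prop :=
  cx_smooth M f /\ forall x v, M x -> tangent_map M f x v 0 -> v = 0.

Definition real_span p q (A : set 'M[C]_(p, q)) : set 'M[C]_(p, q) :=
  [set M | exists k (c : 'I_k -> R) (B : 'I_k -> 'M[C]_(p, q)),
     (forall i, A (B i)) /\ M = \sum_(i < k) (c i)%:C *: B i].

Definition bracket p (A B : 'M[C]_p) : 'M[C]_p := A *m B - B *m A.

Definition left_inv_metric p (ip : 'M[C]_p -> 'M[C]_p -> R)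
    (g v w : 'M[C]_p) : R :=
  ip (invmx g *m v) (invmx g *m w).

Definition left_inv_norm p (ip : 'M[C]_p -> 'M[C]_p -> R) (g v : 'M[C]_p) : R :=
  Num.sqrt (left_inv_metric ip g v v).

Definition conformal p q (ip : 'M[C]_p -> 'M[C]_p -> R)
    (ip' : 'M[C]_q -> 'M[C]_q -> R) (M : set 'M[C]_p)
    (f : 'M[C]_p -> 'M[C]_q) : Prop :=
  exists rho : 'M[C]_p -> R, forall x, M x -> 0 < rho x /\
    forall v v' w w', tangent_map M f x v w -> tangent_map M f x v' w' ->
      left_inv_metric ip' (f x) w w' = rho x * left_inv_metric ip x v v'.

End ComplexMatrices.

Section Groups.
Variable R : realType.
Local Notation C := R[i].

Definition Lam n m : 'M[C]_(n + m) := block_mx (- 1%:M) 0 0 1%:M.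

Definition Unm n m : set 'M[C]_(n + m) :=
  [set Phi | Phi \in unitmx /\ Phi ^t* *m Lam n m *m Phi = Lam n m].

Definition Un n : set 'M[C]_n := [set A | A \is unitarymx].

Definition UxU n m : set 'M[C]_(n + m) :=
  [set block_mx A 0 0 B | A in @Un n & B in @Un m].

Definition h_alg n m : set 'M[C]_(n + m) :=
  [set block_mx A 0 0 B | A in [set A : 'M[C]_n | A ^t* = - A] &
                          B in [set B : 'M[C]_m | B ^t* = - B]].

Definition hat n m (X : 'M[C]_(m, n)) : 'M[C]_(n + m) := block_mx 0 (X ^t*) X 0.

Definition m_space n m : set 'M[C]_(n + m) := range (@hat n m).

Definition Umn m n : set 'M[C]_(m, n) :=
  [set X | exists lam : C, lam != 0 /\ X ^t* *m X = lam%:M].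

Definition mprime n m (X : 'M[C]_(m, n)) : set 'M[C]_(n + m) :=
  real_span [set hat X; hat ('i%C *: X)].

Definition ip_unm p (A B : 'M[C]_p) : R := complex.Re (\tr (A ^t* *m B)) / 2.

Definition SU11 : set 'M[C]_(1 + 1) := [set q | @Unm 1 1 q /\ \det q = 1].

Definition SU1U1 : set 'M[C]_(1 + 1) := [set q | @UxU 1 1 q /\ \det q = 1].

Definition E1 : 'M[C]_(1 + 1) := block_mx 0 1%:M 1%:M 0.
Definition E2 : 'M[C]_(1 + 1) := block_mx 0 (- 'i%C)%:M ('i%C)%:M 0.
Definition E3 : 'M[C]_(1 + 1) := block_mx (- 'i%C)%:M 0 0 ('i%C)%:M.

Definition E_lin (x1 x2 x3 : R) : 'M[C]_(1 + 1) :=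
  x1%:C *: E1 + x2%:C *: E2 + x3%:C *: E3.

(* The coordinates in the basis [E1], [E2], [E3] of su(1,1). *)
Definition crd1 (A : 'M[C]_(1 + 1)) : R := complex.Re (A ord_max ord0).
Definition crd2 (A : 'M[C]_(1 + 1)) : R := complex.Im (A ord_max ord0).
Definition crd3 (A : 'M[C]_(1 + 1)) : R := complex.Im (A ord_max ord_max).

Lemma crd_E_lin x1 x2 x3 :
  [/\ crd1 (E_lin x1 x2 x3) = x1, crd2 (E_lin x1 x2 x3) = x2 &
      crd3 (E_lin x1 x2 x3) = x3].
Proof.
have e0 : ord0 = lshift 1 ord0 :> 'I_(1 + 1) by apply: val_inj.
have e1 : ord_max = rshift 1 ord0 :> 'I_(1 + 1) by apply: val_inj.
have bl (a b c d : 'M[C]_1) : block_mx a b c d ord_max ord0 = c ord0 ord0.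
  by rewrite e0 e1 block_mxEdl.
have br (a b c d : 'M[C]_1) : block_mx a b c d ord_max ord_max = d ord0 ord0.
  by rewrite e1 block_mxEdr.
rewrite /crd1 /crd2 /crd3 /E_lin /E1 /E2 /E3 !(bl, br, mxE) /=.
by rewrite !(mulr0, mul0r, mulr1, addr0, add0r, subr0, oppr0).
Qed.

(* The form for which [E1], [E2], [E3] is orthonormal. *)
Definition ip_su11 (A B : 'M[C]_(1 + 1)) : R :=
  crd1 A * crd1 B + crd2 A * crd2 B + crd3 A * crd3 B.

Definition S21 : set 'M[C]_(2, 1) :=
  [set z | - `|z ord0 ord0| ^+ 2 + `|z ord_max ord0| ^+ 2 = -1].

End Groups.

(* A point of D = U(n,m) / (U(n) x U(m)) is a coset, seen as a set of
   matrices.  The topology and the smooth structure of D are the quotient ones: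
   [prD] is a submersion, so maps into D are smooth when they lift locally to
   smooth maps into U(n,m), and maps out of a subset of D are smooth when their
   composite with [prD] is. *)

Section SymmetricSpace.
Variables (R : realType) (n m : nat).
Local Notation C := R[i].
Local Notation mat := 'M[C]_(n + m).
Local Notation G := (@Unm R n m).
Local Notation H := (@UxU R n m).

Definition prD (g : mat) : set mat := [set g *m h | h in H].

Definition Dnm : set (set mat) := prD @` G.

Definition preD (S : set (set mat)) : set mat := G `&` prD @^-1` S.

Definition D_open (W : set (set mat)) : Prop :=
  W `<=` Dnm /\ exists2 O, cx_open O & preD W = G `&` O.

Definition D_connected (S : set (set mat)) : Prop :=
  forall W1 W2, D_open W1 -> D_open W2 -> S `<=` W1 `|` W2 ->
    S `&` W1 !=set0 -> S `&` W2 !=set0 -> S `&` W1 `&` W2 !=set0.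

Definition smooth_to_D k (U : set 'rV[R]_k) (phi : 'rV[R]_k -> set mat) : Prop :=
  forall u, U u -> exists (V : set 'rV[R]_k) (lift : 'rV[R]_k -> mat),
    [/\ smooth_open V (fun y => realmx (lift y)), V u &
        forall y, U y -> V y -> G (lift y) /\ prD (lift y) = phi y].

Definition smooth_from_D (F : normedModType R) (B : set (set mat))
    (psi : set mat -> F) : Prop :=
  smooth (@realmx R _ _ @` preD B) (fun x => psi (prD (cplxmx x))).

Definition D_submanifold k (S : set (set mat)) : Prop :=
  S `<=` Dnm /\ forall s, S s -> exists (W : set (set mat)) (U : set 'rV[R]_k)
      (phi : 'rV[R]_k -> set mat) (psi : set mat -> 'rV[R]_k),
    [/\ D_open W /\ W s, open U,
        smooth_to_D U phi /\ smooth_from_D (S `&` W) psi,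
        forall u, U u -> (S `&` W) (phi u) /\ psi (phi u) = u &
        forall x, (S `&` W) x -> U (psi x) /\ phi (psi x) = x].

(* The frame [g] of U(n,m) over the point [prD g] identifies the tangent space
   of D at [prD g] with [m_space]: the vector with coordinate [A] is the
   image under [prD] of [g *m A], and vectors of [g *m h_alg] are vertical.
   [D_tangent S g] is the tangent space of [S] at [prD g] in this frame; at
   [g = 1] the identification is that of [m_space] with the tangent space at
   the origin. *)
Definition D_tangent (S : set (set mat)) (g : mat) : set mat :=
  [set A | @m_space R n m A /\ exists c B, @h_alg R n m B /\
           curve_at (preD S) c g (g *m (A + B))].

(* In the canonical connection, the horizontal curves of U(n,m) are those with
   velocity in [g *m m_space], and a horizontal lift [c] of a curve of D is a
   parallel frame along it.  If [A t] is the coordinate in the frame [c t] of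
   the velocity of the curve, then its covariant derivative has coordinate
   [A' t]; the curve is a geodesic when [A' = 0]. *)
Definition geodesic (gam : R -> set mat) (g A0 : mat) : Prop :=
  exists c A : R -> mat,
    [/\ forall t, [/\ G (c t), @m_space R n m (A t) &
                      has_velocity c t (c t *m A t)],
        forall t, has_velocity A t 0,
        c 0 = g, A 0 = A0 & forall t, gam t = prD (c t)].

Definition totally_geodesic (S : set (set mat)) : Prop :=
  forall g A gam, preD S g -> D_tangent S g A -> geodesic gam g A ->
    \forall t \near (0 : R), S (gam t).

(* The geodesics of a totally geodesic submanifold are the geodesics of D
   that it contains. *)
Definition geodesically_complete (S : set (set mat)) : Prop :=
  forall g A, preD S g -> D_tangent S g A ->
    exists2 gam, geodesic gam g A & forall t, S (gam t).

Definition complete_totally_geodesic k (S : set (set mat)) : Prop :=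
  [/\ D_connected S, D_submanifold k S, totally_geodesic S &
      geodesically_complete S].

Definition origin : set mat := prD 1%:M.

Definition translate (a : mat) (S : set (set mat)) : set (set mat) :=
  [set [set a *m g | g in s] | s in S].

Definition arises_from (m' : set mat) k (S : set (set mat)) : Prop :=
  [/\ complete_totally_geodesic k S, S origin & D_tangent S 1%:M = m'].

Definition generated_distribution (m' : set mat) : set mat :=
  real_span (m' `|` [set bracket A B | A in m' & B in m']).

(* Integral manifolds of the left-invariant distribution with value [Delta] at
   the identity. *)
Definition integral_manifold (Delta P : set mat) : Prop :=
  [/\ P `<=` G, exists k, cx_submanifold k P &
      forall g, P g -> tangent_space P g = [set g *m A | A in Delta]].

(* [P] is a principal U(1)-bundle over [S], with U(1) acting by
   [g . u = g *m kap u], contained in the principal bundle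
   U(n) x U(m) -> preD S -> S, as the reduction to the subgroup [kap @` U(1)].
   Local triviality is expressed by local sections. *)
Definition U1_subbundle (kap : 'M[C]_1 -> mat) (S : set (set mat))
    (P : set mat) : Prop :=
  [/\ [/\ kap @` @Un R 1 `<=` H,
          forall u v, Un u -> Un v -> kap (u *m v) = kap u *m kap v &
          cx_diffeo (@Un R 1) (kap @` @Un R 1) kap],
      P `<=` preD S, exists k, cx_submanifold k P,
      forall g h, P g -> H h -> (P (g *m h) <-> (kap @` @Un R 1) h) &
      forall s, S s -> exists W (sigma : set mat -> mat),
        [/\ D_open W, W s,
            smooth_from_D (S `&` W) (fun x => realmx (sigma x)) &
            forall x, (S `&` W) x -> P (sigma x) /\ prD (sigma x) = x]].

Definition induced_by (m' : set mat) (S : set (set mat)) (P : set mat) : Prop :=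
  [/\ integral_manifold (generated_distribution m') P, cx_connected P &
      prD @` P = S].

(* [(f, rho)] is a homomorphism of principal bundles from
   S(U(1) x U(1)) -> SU(1,1) -> SU(1,1) / S(U(1) x U(1))
   to U(n) x U(m) -> U(n,m) -> D. *)
Definition SU11_bundle_map (f rho : 'M[C]_(1 + 1) -> mat) : Prop :=
  [/\ cx_smooth (@SU11 R) f /\ f @` @SU11 R `<=` G,
      cx_smooth (@SU1U1 R) rho /\ rho @` @SU1U1 R `<=` H,
      forall k l, SU1U1 k -> SU1U1 l -> rho (k *m l) = rho k *m rho l &
      forall q k, SU11 q -> SU1U1 k -> f (q *m k) = f q *m rho k].

(* The Hopf bundle is S21 with U(1) acting by scalars (1 x 1 matrices on the
   right); an equivariant diffeomorphism of total spaces induces the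
   diffeomorphism of the quotients. *)
Definition isomorphic_to_Hopf (kap : 'M[C]_1 -> mat) (P : set mat) : Prop :=
  exists F : mat -> 'M[C]_(2, 1), cx_diffeo P (@S21 R) F /\
    forall g u, P g -> Un u -> F (g *m kap u) = F g *m u.

End SymmetricSpace.

(* Main.v *)
Require Import Defs.
From mathcomp Require Import all_boot all_order all_algebra.
From mathcomp Require Import all_classical all_reals all_analysis.
From mathcomp Require Import complex ring lra.

(** Scale [X] to [X = r Y] with [r > 0] real and [Y^* Y = 1]. For every [i < n]
    the vectors [(e_i, 0)] and [(0, Y e_i)] span a copy of C^{1,1} inside
    C^{n,m}, and these [n] copies are orthogonal to each other both for the
    standard Hermitian product and for the indefinite form. Letting a 2 x 2
    matrix act on all copies at once gives [amp M], and adding the identity of the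
    orthogonal complement gives [emb M]. Since the copies are orthonormal,
    [emb] is multiplicative ([embM]), commutes with adjoints ([emb_adj]), maps the
    form of signature (1,1) to the one of signature (n,m) ([emb_Lam]), and has
    the compression to one copy as a linear left inverse ([compress_emb]). So
    [emb] embeds SU(1,1) in U(n,m); its differential is [amp], which sends
    the off-diagonal part of su(1,1) onto m' ([hat_su], [mprime_amp]), and
    [amp] multiplies traces by [n] ([amp_tr]), which is the factor [sqrt n] of
    the metric statement.

    The surface through the origin is [disc], the set of cosets of
    [emb q] for [q] in SU(1,1). A coset [g H] is determined by [g g^*], and a
    point of [disc] has [g g^*] in the range of the affine map [emb].
    Differentiating this along a curve of [disc] whose velocity has horizontal
    coordinate [A] shows that [2 g A g^*] lies in the range of [amp]; at
    [g = emb q * h] this forces [h A h^*] to be some [amp (su 0 b)]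
    ([D_tangent_disc_sub]). The geodesic with this initial velocity is then
    [prD (emb (q * exp (t * su 0 b)))], by uniqueness for the linear equation
    [c' = c A], and it never leaves [disc] ([geodesic_exp], [exp_geodesic]).
    Since [g g^*] depends on the coset only, the positive square root of its
    compression is a smooth function on cosets; it gives a global section
    ([polarD_disc]) and a global chart ([disc_submanifold]).

    SU(1,1) consists of the matrices [su a c] with [|a|^2 - |c|^2 = 1]
    ([SU11P]), so that taking the first column identifies it with S^{2,1},
    equivariantly for the circle of matrices [su u 0] acting on the right. The
    subbundle over the translate of [disc] by [a] is the image of
    [q |-> a * emb q]. It is transported from SU(1,1) by this affine map and its
    affine inverse [pull], which yields its charts ([bundle_submanifold]), its
    tangent spaces ([bundle_tangent]) and the isomorphism with the Hopf bundle
    ([bundle_Hopf]). It is an integral manifold of the distribution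
    generated by m' because the bracket of the two generators of m' is the
    missing diagonal direction of [amp] of su(1,1)
    ([generated_distribution_amp]). *)

Set Implicit Arguments.
Unset Strict Implicit.
Unset Printing Implicit Defensive.

Import Order.TTheory GRing.Theory Num.Theory.
Import numFieldNormedType.Exports.

Local Open Scope classical_set_scope.
Local Open Scope complex_scope.
Local Open Scope ring_scope.
Local Open Scope sesquilinear_scope.

Local Notation realmx := Defs.realmx.

(** * Smooth functions on open sets *)

(** Differentiability is local; together with the sum rule this lets a
    differentiable function be changed away from the point. *)
Lemma differentiable_near0 (R : realType) (E F : normedModType R) (e : E -> F) x :
  (\forall y \near x, e y = 0) -> differentiable e x.
Proof.
move=> e0.
have e0' : \forall y \near (0 : E), e (y + x) = 0.
  by move: e0; rewrite (near_shift (0 : E)) /= subr0.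
have H : e \o shift x = cst (e x) + (\0 : {linear E -> F}) +o_ (0 : E) id.
  apply/eqaddoP => _/posnumP[eps]; near=> y.
  have ey : e (y + x) = 0 by near: y.
  have -> : (e \o shift x - (cst (e x) + \0)) y = e (y + x) - (e x + 0) by [].
  by rewrite ey (nbhs_singleton e0) addr0 subr0 normr0 mulr_ge0.
apply/diff_locallyP; rewrite (diff_unique _ H) //.
  by split=> //; apply: cst_continuous.
by apply: cst_continuous.
Unshelve. all: by end_near. Qed.

Section CkCalculus.
Context {R : realType} {E : normedModType R}.
Variables (U : set E) (Uo : open U).

(** This justifies every derivative rule below: the rules hold only on [U],
    whereas [Ck] speaks of the derivative as a total function. *)
Lemma Ck_ext (F : normedModType R) k (f g : E -> F) :
  (forall x, U x -> f x = g x) -> Ck k U f -> Ck k U g.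
Proof.
have nearU x : U x -> \forall y \near x, U y by move=> Ux; apply: open_nbhs_nbhs.
elim: k f g => [|k IH] f g fg /=.
  move=> cf x Ux; rewrite /prop_for /continuous_at -(fg x Ux).
  apply: cvg_trans (cf x Ux); apply: near_eq_cvg.
  by near=> y; apply: fg; near: y; exact: nearU.
case=> df Df; split => [x Ux|v].
  have nfg : {near x, f =1 g}.
    by near=> y; apply: fg; near: y; exact: nearU.
  have -> : g = f + (fun y => g y - f y) by apply/funext => y; rewrite fctE subrKC.
  apply: differentiableD; first exact: df.
  by apply: differentiable_near0; near=> y; rewrite fg ?subrr //; near: y; exact: nearU.
apply: IH (Df v) => x Ux; apply: near_eq_derive.
by near=> y; apply: fg; near: y; exact: nearU.
Unshelve. all: end_near. Qed.

Lemma CkW (F : normedModType R) k (f : E -> F) : Ck k.+1 U f -> Ck k U f.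
Proof.
elim: k f => [|k IH] f [df Df].
  by move=> x Ux; apply: differentiable_continuous; apply: df.
by split=> // v; apply: IH; apply: Df.
Qed.

Lemma Ck_cst (F : normedModType R) k (c : F) : Ck k U (cst c).
Proof.
elim: k c => [|k IH] c /=; first by move=> x Ux; apply: cst_continuous.
split=> [x Ux|v]; first exact: differentiable_cst.
by apply: Ck_ext (IH 0) => x Ux; rewrite derive_cst.
Qed.

Lemma Ck_lin (F : normedModType R) k (f : {linear E -> F}) :
  continuous f -> Ck k U f.
Proof.
move=> fc; case: k => [|k] /=; first by move=> x _; apply: fc.
split=> [x Ux|v]; first exact: linear_differentiable.
apply: Ck_ext (Ck_cst k (f v)) => x Ux.
by rewrite deriveE ?diff_lin //; exact: linear_differentiable.
Qed.

Lemma CkD (F : normedModType R) k (f g : E -> F) :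
  Ck k U f -> Ck k U g -> Ck k U (f \+ g).
Proof.
elim: k f g => [|k IH] f g /=.
  by move=> cf cg x Ux; apply: continuousD; [apply: cf|apply: cg].
move=> [df Df] [dg Dg]; split=> [x Ux|v].
  by apply: differentiableD; [apply: df|apply: dg].
apply: Ck_ext (IH _ _ (Df v) (Dg v)) => x Ux /=.
by rewrite deriveD //; apply: diff_derivable; [apply: df|apply: dg].
Qed.

Lemma CkZl (F : normedModType R) k (f : E -> R) (w : F) :
  Ck k U f -> Ck k U (fun x => f x *: w).
Proof.
elim: k f => [|k IH] f /=.
  by move=> cf x Ux; apply: continuousZr_tmp; apply: cf.
move=> [df Df]; split=> [x Ux|v].
  by apply: differentiableZl; apply: df.
apply: Ck_ext (IH _ (Df v)) => x Ux /=.
rewrite !deriveE ?diffZl //; by [exact: df | apply: differentiableZl; exact: df].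
Qed.

Lemma CkM k (f g : E -> R) : Ck k U f -> Ck k U g -> Ck k U (f \* g).
Proof.
elim: k f g => [|k IH] f g.
  by move=> cf cg x Ux; apply: continuousM; [apply: cf|apply: cg].
move=> Cf Cg; have [Cfk Cgk] := (CkW Cf, CkW Cg).
case: Cf Cg => [df Df] [dg Dg]; split=> [x Ux|v].
  by apply: differentiableM; [apply: df|apply: dg].
apply: Ck_ext (CkD (IH _ _ Cfk (Dg v)) (IH _ _ Cgk (Df v))) => x Ux /=.
by rewrite deriveM //; apply: diff_derivable; [apply: df|apply: dg].
Qed.

Lemma CkN k (f : E -> R) : Ck k U f -> Ck k U (\- f).
Proof.
move=> cf; have C1 : Ck k U (cst (-1 : R)) := Ck_cst k _.
apply: (Ck_ext _ (CkM C1 cf)) => x Ux /=.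
by rewrite mulN1r.
Qed.

(** Chain rule for an outer function of one real variable. *)
Lemma derive_comp_real (phi : R -> R) (f : E -> R) x v dphi :
  is_derive (f x) (1 : R) phi dphi -> differentiable f x ->
  differentiable (phi \o f) x /\ 'D_v (phi \o f) x = dphi * 'D_v f x.
Proof.
move=> [phid phiE] df; have dphif : differentiable phi (f x).
  exact/derivable1_diffP.
have dc : differentiable (phi \o f) x by apply: differentiable_comp.
split=> //; rewrite (deriveE _ dc) diff_comp //= -(deriveE _ df).
rewrite -[X in 'd phi _ X]mulr1 [LHS]linearZ /= -deriveE // phiE.
exact: mulrC.
Qed.

(** The only non-polynomial algebraic function in the charts: both [sqrt x =
    x * rsqrt x] and the normalization of square roots reduce to it, and its
    derivative is a polynomial in it. *)
Definition rsqrt (x : R) : R := (Num.sqrt x)^-1.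

Lemma is_derive_rsqrt (x : R) :
  0 < x -> is_derive x (1 : R) rsqrt (- 2^-1 * rsqrt x ^+ 3).
Proof.
move=> x0; have s0 : Num.sqrt x != 0 by rewrite gt_eqF // sqrtr_gt0.
have [sd sE] := is_derive1_sqrt x0.
apply: DeriveDef; first exact: derivableV.
rewrite (deriveV s0 sd) sE /rsqrt /GRing.scale /=.
by move: (Num.sqrt x) s0 => s s0; field.
Qed.

Lemma Ck_rsqrt k (f : E -> R) :
  (forall x, U x -> 0 < f x) -> Ck k U f -> Ck k U (rsqrt \o f).
Proof.
move=> f0; elim: k => [|k IH].
  move=> cf x Ux; apply: continuousV.
    by rewrite gt_eqF // sqrtr_gt0 f0.
  exact: (continuous_comp (cf x Ux) (@sqrt_continuous R (f x))).
move=> Cf; have Ck_ := IH (CkW Cf); case: Cf => df Df.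
have D x v (Ux : U x) := derive_comp_real v (is_derive_rsqrt (f0 x Ux)) (df x Ux).
split=> [x Ux|v]; first by have [] := D x 0 Ux.
have C2 : Ck k U (cst (- 2^-1 : R)) := Ck_cst k _.
have C3 := CkM (CkM Ck_ (CkM Ck_ Ck_)) (Df v).
apply: (Ck_ext _ (CkM C2 C3)) => x Ux /=.
by have [_ ->] := D x v Ux; rewrite /=; ring.
Qed.

Lemma Ck_cos_sin k (f : E -> R) :
  Ck k U f -> Ck k U (cos \o f) /\ Ck k U (sin \o f).
Proof.
elim: k => [|k IH].
  move=> cf; split=> x Ux.
    exact: (continuous_comp (cf x Ux) (@continuous_cos R (f x))).
  exact: (continuous_comp (cf x Ux) (@continuous_sin R (f x))).
move=> Cf; have [Cc Cs] := IH (CkW Cf); case: Cf => df Df.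
have Dc x v (Ux : U x) := derive_comp_real v (is_derive_cos (f x)) (df x Ux).
have Ds x v (Ux : U x) := derive_comp_real v (is_derive_sin (f x)) (df x Ux).
split; split=> [x Ux|v].
- by have [] := Dc x 0 Ux.
- apply: (Ck_ext _ (CkM (CkN Cs) (Df v))) => x Ux /=.
  by have [_ ->] := Dc x v Ux.
- by have [] := Ds x 0 Ux.
- apply: (Ck_ext _ (CkM Cc (Df v))) => x Ux /=.
  by have [_ ->] := Ds x v Ux.
Qed.

Lemma Ck_mx k p q (f : E -> 'M[R]_(p, q)) :
  (forall i j, Ck k U (fun x => f x i j)) -> Ck k U f.
Proof.
move=> cf.
have Csum (T : Type) (s : seq T) (g : T -> E -> 'M[R]_(p, q)) :
    (forall t, Ck k U (g t)) -> Ck k U (fun x => \sum_(t <- s) g t x).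
  move=> cg; elim: s => [|t s IH].
    by apply: Ck_ext (Ck_cst k 0) => x _; rewrite big_nil.
  by apply: Ck_ext (CkD (cg t) IH) => x _; rewrite big_cons.
have Cs : Ck k U (fun x => \sum_i \sum_j f x i j *: delta_mx i j).
  by apply: (Csum _) => i; apply: (Csum _) => j; apply: CkZl.
by apply: Ck_ext Cs => x _; rewrite -matrix_sum_delta.
Qed.

End CkCalculus.

Section ComplexParts.
Variable R : realType.
Implicit Types x y : R[i].

Lemma cReM x y :
  complex.Re (x * y) = complex.Re x * complex.Re y - complex.Im x * complex.Im y.
Proof. by case: x y => [a b] [c d]. Qed.

Lemma cImM x y :
  complex.Im (x * y) = complex.Re x * complex.Im y + complex.Im x * complex.Re y.
Proof. by case: x y => [a b] [c d]. Qed.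

Lemma cReD x y : complex.Re (x + y) = complex.Re x + complex.Re y.
Proof. by case: x y => [a b] [c d]. Qed.

Lemma cImD x y : complex.Im (x + y) = complex.Im x + complex.Im y.
Proof. by case: x y => [a b] [c d]. Qed.

Lemma cReN x : complex.Re (- x) = - complex.Re x. Proof. by case: x. Qed.

Lemma cImN x : complex.Im (- x) = - complex.Im x. Proof. by case: x. Qed.

Lemma cReJ x : complex.Re (Num.conj x) = complex.Re x. Proof. by case: x. Qed.

Lemma cImJ x : complex.Im (Num.conj x) = - complex.Im x. Proof. by case: x. Qed.

Lemma conj_add x y : Num.conj (x + y) = Num.conj x + Num.conj y.
Proof. exact: rmorphD. Qed.

Lemma conj_mul x y : Num.conj (x * y) = Num.conj x * Num.conj y.
Proof. exact: rmorphM. Qed.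

Lemma conj_opp x : Num.conj (- x) = - Num.conj x.
Proof. exact: rmorphN. Qed.

Definition cReImE := (cReM, cImM, cReD, cImD, cReN, cImN, cReJ, cImJ).

Lemma complex_eqP x y :
  complex.Re x = complex.Re y -> complex.Im x = complex.Im y -> x = y.
Proof. by case: x y => [a b] [c d] /= -> ->. Qed.

End ComplexParts.

Section Adjoint.
Variable R : realType.
Local Notation C := R[i].

Lemma adjmxM p q r (A : 'M[C]_(p, q)) (B : 'M[C]_(q, r)) :
  (A *m B)^t* = B^t* *m A^t*.
Proof. by rewrite trmx_mul map_mxM. Qed.

Lemma adjmxD p q (A B : 'M[C]_(p, q)) : (A + B)^t* = A^t* + B^t*.
Proof. by rewrite linearD map_mxD. Qed.

Lemma adjmxN p q (A : 'M[C]_(p, q)) : (- A)^t* = - A^t*.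
Proof. by rewrite linearN map_mxN. Qed.

Lemma adjmxZ p q z (A : 'M[C]_(p, q)) : (z *: A)^t* = Num.conj z *: A^t*.
Proof. by rewrite linearZ map_mxZ. Qed.

Lemma adjmxK p q (A : 'M[C]_(p, q)) : A^t*^t* = A.
Proof. by apply/matrixP => i j; rewrite !mxE conjCK. Qed.

Lemma adjmx1 p : (1%:M : 'M[C]_p)^t* = 1%:M.
Proof. by rewrite trmx1 map_mx1. Qed.

Lemma adj_scalar p z : (z%:M : 'M[C]_p)^t* = (Num.conj z)%:M.
Proof. by rewrite tr_scalar_mx map_scalar_mx. Qed.

Lemma adj_sum p q (I : finType) (F : I -> 'M[C]_(p, q)) :
  (\sum_i F i)^t* = \sum_i (F i)^t*.
Proof. by rewrite raddf_sum -map_mx_sum. Qed.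

Lemma adj_block p q r s (A : 'M[C]_(p, q)) (B : 'M[C]_(p, r)) (D : 'M[C]_(s, q))
    (F : 'M[C]_(s, r)) :
  (block_mx A B D F)^t* = block_mx (A^t* ) (D^t* ) (B^t* ) (F^t* ).
Proof. by rewrite tr_block_mx map_block_mx. Qed.

End Adjoint.

Section SmoothComplex.
Context {R : realType} {E : normedModType R}.
Variables (U : set E) (Uo : open U).
Local Notation C := R[i].
Implicit Types z w : E -> C.

(** Smoothness through real and imaginary parts, so that only real-valued
    functions are ever differentiated. *)
Definition csmooth z : Prop := forall k,
  Ck k U (fun x => complex.Re (z x)) /\ Ck k U (fun x => complex.Im (z x)).

Definition mxsmooth p q (F : E -> 'M[C]_(p, q)) : Prop :=
  forall i j, csmooth (fun x => F x i j).

Lemma csmooth_ext z w : z =1 w -> csmooth z -> csmooth w.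
Proof. by move=> /funext ->. Qed.

Lemma csmooth_cst (a : C) : csmooth (cst a).
Proof. by move=> k; split; apply: Ck_cst. Qed.

Lemma csmooth_real (r : E -> R) :
  (forall k, Ck k U r) -> csmooth (fun x => (r x)%:C).
Proof. by move=> Cr k; split=> //; apply: Ck_cst. Qed.

Lemma csmoothD z w : csmooth z -> csmooth w -> csmooth (fun x => z x + w x).
Proof.
move=> Cz Cw k; have [[Cz1 Cz2] [Cw1 Cw2]] := (Cz k, Cw k); split.
  by apply: (Ck_ext Uo _ (CkD Uo Cz1 Cw1)) => x _ /=; rewrite cReD.
by apply: (Ck_ext Uo _ (CkD Uo Cz2 Cw2)) => x _ /=; rewrite cImD.
Qed.

Lemma csmoothM z w : csmooth z -> csmooth w -> csmooth (fun x => z x * w x).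
Proof.
move=> Cz Cw k; have [[Cz1 Cz2] [Cw1 Cw2]] := (Cz k, Cw k); split.
  apply: (Ck_ext Uo _ (CkD Uo (CkM Uo Cz1 Cw1) (CkN Uo (CkM Uo Cz2 Cw2)))).
  by move=> x _ /=; rewrite cReM.
apply: (Ck_ext Uo _ (CkD Uo (CkM Uo Cz1 Cw2) (CkM Uo Cz2 Cw1))) => x _ /=.
by rewrite cImM.
Qed.

Lemma csmooth_conj z : csmooth z -> csmooth (fun x => Num.conj (z x)).
Proof.
move=> Cz k; have [Cz1 Cz2] := Cz k; split.
  by apply: (Ck_ext Uo _ Cz1) => x _; rewrite cReJ.
by apply: (Ck_ext Uo _ (CkN Uo Cz2)) => x _; rewrite cImJ.
Qed.

Lemma csmooth_sum (I : Type) (s : seq I) (z : I -> E -> C) :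
  (forall i, csmooth (z i)) -> csmooth (fun x => \sum_(i <- s) z i x).
Proof.
move=> Cz; elim: s => [|i s IH].
  by apply: (csmooth_ext _ (csmooth_cst 0)) => x; rewrite big_nil.
by apply: (csmooth_ext _ (csmoothD (Cz i) IH)) => x; rewrite big_cons.
Qed.

Lemma mxsmooth_ext p q (F G : E -> 'M[C]_(p, q)) :
  F =1 G -> mxsmooth F -> mxsmooth G.
Proof. by move=> /funext ->. Qed.

Lemma mxsmooth_cst p q (A : 'M[C]_(p, q)) : mxsmooth (cst A).
Proof. by move=> i j; apply: csmooth_cst. Qed.

Lemma mxsmoothD p q (F G : E -> 'M[C]_(p, q)) :
  mxsmooth F -> mxsmooth G -> mxsmooth (fun x => F x + G x).
Proof.
move=> CF CG i j; apply: (csmooth_ext _ (csmoothD (CF i j) (CG i j))) => x.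
by rewrite mxE.
Qed.

Lemma mxsmoothZ p q z (F : E -> 'M[C]_(p, q)) :
  csmooth z -> mxsmooth F -> mxsmooth (fun x => z x *: F x).
Proof.
move=> Cz CF i j; apply: (csmooth_ext _ (csmoothM Cz (CF i j))) => x.
by rewrite mxE.
Qed.

Lemma mxsmoothM p q r (F : E -> 'M[C]_(p, q)) (G : E -> 'M[C]_(q, r)) :
  mxsmooth F -> mxsmooth G -> mxsmooth (fun x => F x *m G x).
Proof.
move=> CF CG i j.
have CS := csmooth_sum (index_enum 'I_q) (fun k => csmoothM (CF i k) (CG k j)).
by apply: (csmooth_ext _ CS) => x; rewrite mxE.
Qed.

Lemma mxsmooth_adj p q (F : E -> 'M[C]_(p, q)) :
  mxsmooth F -> mxsmooth (fun x => (F x)^t*).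
Proof.
move=> CF i j; apply: (csmooth_ext _ (csmooth_conj (CF j i))) => x.
by rewrite !mxE.
Qed.

Lemma mxsmooth_sum p q (I : Type) (s : seq I) (F : I -> E -> 'M[C]_(p, q)) :
  (forall i, mxsmooth (F i)) -> mxsmooth (fun x => \sum_(i <- s) F i x).
Proof.
move=> CF i j; apply: (csmooth_ext _ (csmooth_sum s (fun k => CF k i j))) => x.
by rewrite summxE.
Qed.

Lemma mxsmooth_scalar p z : csmooth z -> mxsmooth (fun x => (z x)%:M : 'M[C]_p).
Proof.
move=> Cz; apply: (mxsmooth_ext _ (mxsmoothZ Cz (mxsmooth_cst 1%:M))) => x.
by rewrite scalemx1.
Qed.

Lemma mxsmooth_block p q r s (A : E -> 'M[C]_(p, q)) (B : E -> 'M[C]_(p, r))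
    (D : E -> 'M[C]_(s, q)) (F : E -> 'M[C]_(s, r)) :
  mxsmooth A -> mxsmooth B -> mxsmooth D -> mxsmooth F ->
  mxsmooth (fun x => block_mx (A x) (B x) (D x) (F x)).
Proof.
move=> CA CB CD CF i j.
case: (split_ordP i) => i' ->; case: (split_ordP j) => j' ->.
- by apply: (csmooth_ext _ (CA i' j')) => x; rewrite block_mxEul.
- by apply: (csmooth_ext _ (CB i' j')) => x; rewrite block_mxEur.
- by apply: (csmooth_ext _ (CD i' j')) => x; rewrite block_mxEdl.
- by apply: (csmooth_ext _ (CF i' j')) => x; rewrite block_mxEdr.
Qed.

Lemma smooth_open_realmx p q (F : E -> 'M[C]_(p, q)) :
  mxsmooth F -> smooth_open U (fun x => realmx (F x)).
Proof.
move=> CF; split=> // k; apply: Ck_mx => // i j.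
case: (split_ordP j) => j' ->.
  by apply: (Ck_ext Uo _ (CF i j' k).1) => x _; rewrite row_mxEl mxE.
by apply: (Ck_ext Uo _ (CF i j' k).2) => x _; rewrite row_mxEr mxE.
Qed.

Lemma smooth_open_rowmx q (F : E -> 'rV[R]_q) :
  (forall j k, Ck k U (fun x => F x 0 j)) -> smooth_open U F.
Proof. by move=> CF; split=> // k; apply: Ck_mx => // i j; rewrite ord1. Qed.

End SmoothComplex.

Section SmoothCoordinates.
Variable R : realType.
Local Notation C := R[i].

Lemma Ck_coord k p q (U : set 'M[R]_(p, q)) i j :
  open U -> Ck k U (fun x => x i j).
Proof.
move=> Uo; have @f : {linear 'M[R]_(p, q) -> R}.
  by exists (fun N : 'M[R]_(_, _) => N i j); do 2![eexists]; do ?[constructor];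
     rewrite ?mxE// => ? *; rewrite ?mxE//; move=> ?; rewrite !mxE.
by apply: (@Ck_lin _ _ U Uo _ k f); exact: coord_continuous.
Qed.

Lemma mxsmooth_cplxmx p q (U : set 'M[R]_(p, q + q)) :
  open U -> mxsmooth U (@cplxmx R p q).
Proof.
move=> Uo i j k; split.
  apply: (Ck_ext Uo _ (Ck_coord k i (lshift q j) Uo)) => x _.
  by rewrite !mxE.
apply: (Ck_ext Uo _ (Ck_coord k i (rshift q j) Uo)) => x _.
by rewrite !mxE.
Qed.

Lemma cx_smoothT p q p' q' (A : set 'M[C]_(p, q)) (f : 'M[C]_(p, q) -> 'M[C]_(p', q')) :
  mxsmooth setT (fun x => f (cplxmx x)) -> cx_smooth A f.
Proof.
move=> Cf x _; exists setT, (fun x => realmx (f (cplxmx x))).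
by split=> //; apply: smooth_open_realmx Cf; apply: openT.
Qed.

(** A globally smooth function is smooth on any subset, being its own
    extension. *)
Lemma smooth_cx_imageT (F : normedModType R) p q (B : set F)
    (f : F -> 'M[C]_(p, q)) : mxsmooth setT f -> smooth B (fun x => realmx (f x)).
Proof.
move=> Cf x _; exists setT, (fun x => realmx (f x)); split=> //.
by apply: smooth_open_realmx Cf; apply: openT.
Qed.

Lemma realmx_image p q (A : set 'M[C]_(p, q)) x :
  (@realmx R p q @` A) x <-> A (cplxmx x).
Proof.
split=> [[y Ay <-]|Ax]; first by rewrite realmxK.
by exists (cplxmx x) => //; rewrite cplxmxK.
Qed.

Lemma realmx_imageE p q (A : set 'M[C]_(p, q)) :
  @realmx R p q @` A = @cplxmx R p q @^-1` A.
Proof. by apply/seteqP; split=> x /realmx_image. Qed.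

End SmoothCoordinates.

(** * Velocities of curves of complex matrices *)

Section Velocity.
Variable R : realType.
Local Notation C := R[i].

Definition cderiv (z : R -> C) (t : R) (v : C) : Prop :=
  is_derive t (1 : R) (fun s => complex.Re (z s)) (complex.Re v) /\
  is_derive t (1 : R) (fun s => complex.Im (z s)) (complex.Im v).

(** Velocities can be computed entry by entry, which turns the ring
    operations on complex scalars into the product rule for matrices. *)
Lemma has_velocityP p q (c : R -> 'M[C]_(p, q)) t v :
  has_velocity c t v <-> forall i j, cderiv (fun s => c s i j) t (v i j).
Proof.
rewrite /has_velocity; split=> [[cd cv] i j|cd].
  have e1 : (fun s => realmx (c s) i (lshift q j)) = (fun s => complex.Re (c s i j)).
    by apply/funext => s; rewrite row_mxEl mxE.
  have e2 : (fun s => realmx (c s) i (rshift q j)) = (fun s => complex.Im (c s i j)).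
    by apply/funext => s; rewrite row_mxEr mxE.
  have /derivable_mxP cd' := cd; move: cv; rewrite derive_mx // => /matrixP cv.
  split; apply: DeriveDef.
  - by have := cd' i (lshift q j); rewrite e1.
  - by have := cv i (lshift q j); rewrite row_mxEl !mxE e1.
  - by have := cd' i (rshift q j); rewrite e2.
  - by have := cv i (rshift q j); rewrite row_mxEr !mxE e2.
have e1 i j : (fun s => realmx (c s) i (lshift q j)) = (fun s => complex.Re (c s i j)).
  by apply/funext => s; rewrite row_mxEl mxE.
have e2 i j : (fun s => realmx (c s) i (rshift q j)) = (fun s => complex.Im (c s i j)).
  by apply/funext => s; rewrite row_mxEr mxE.
have dc : derivable (fun s => realmx (c s)) t (1 : R).
  apply/derivable_mxP => i j; case: (split_ordP j) => j' ->.
    by rewrite e1; have [[]] := cd i j'.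
  by rewrite e2; have [_ []] := cd i j'.
apply: DeriveDef => //; rewrite derive_mx //; apply/matrixP => i j.
case: (split_ordP j) => j' ->; rewrite mxE.
  by rewrite e1 row_mxEl mxE; have [[_ ->]] := cd i j'.
by rewrite e2 row_mxEr mxE; have [_ [_ ->]] := cd i j'.
Qed.

Lemma real_deriv_eq (f : R -> R) t v w :
  is_derive t (1 : R) f v -> v = w -> is_derive t (1 : R) f w.
Proof. by move=> h <-. Qed.

Lemma cderiv_cst (a : C) t : cderiv (cst a) t 0.
Proof. by split; apply: is_derive_cst. Qed.

Lemma cderiv_eq (z : R -> C) t v w : cderiv z t v -> v = w -> cderiv z t w.
Proof. by move=> h <-. Qed.

Lemma cderivD (z w : R -> C) t v u :
  cderiv z t v -> cderiv w t u -> cderiv (fun s => z s + w s) t (v + u).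
Proof.
move=> [z1 z2] [w1 w2]; split.
  have -> : (fun s => complex.Re (z s + w s)) =
    (fun s => complex.Re (z s)) + (fun s => complex.Re (w s)).
    by apply/funext => s; rewrite cReD.
  by rewrite cReD; apply: is_deriveD.
have -> : (fun s => complex.Im (z s + w s)) =
  (fun s => complex.Im (z s)) + (fun s => complex.Im (w s)).
  by apply/funext => s; rewrite cImD.
by rewrite cImD; apply: is_deriveD.
Qed.

Lemma cderivM (z w : R -> C) t v u :
  cderiv z t v -> cderiv w t u ->
  cderiv (fun s => z s * w s) t (v * w t + z t * u).
Proof.
move=> [z1 z2] [w1 w2]; split.
  have -> : (fun s => complex.Re (z s * w s)) =
    (fun s => complex.Re (z s)) * (fun s => complex.Re (w s)) -
    (fun s => complex.Im (z s)) * (fun s => complex.Im (w s)).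
    by apply/funext => s; rewrite cReM.
  apply: real_deriv_eq (is_deriveB (is_deriveM z1 w1) (is_deriveM z2 w2)) _.
  by rewrite !cReImE /GRing.scale /=; ring.
have -> : (fun s => complex.Im (z s * w s)) =
  (fun s => complex.Re (z s)) * (fun s => complex.Im (w s)) +
  (fun s => complex.Im (z s)) * (fun s => complex.Re (w s)).
  by apply/funext => s; rewrite cImM.
apply: real_deriv_eq (is_deriveD (is_deriveM z1 w2) (is_deriveM z2 w1)) _.
by rewrite !cReImE /GRing.scale /=; ring.
Qed.

Lemma cderiv_conj (z : R -> C) t v :
  cderiv z t v -> cderiv (fun s => Num.conj (z s)) t (Num.conj v).
Proof.
move=> [z1 z2]; split.
  by rewrite cReJ; under eq_fun do rewrite cReJ.
have -> : (fun s => complex.Im (Num.conj (z s))) = - (fun s => complex.Im (z s)).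
  by apply/funext => s; rewrite cImJ.
by rewrite cImJ; apply: is_deriveN.
Qed.

Lemma cderiv_real (r : R -> R) t v :
  is_derive t (1 : R) r v -> cderiv (fun s => (r s)%:C) t v%:C.
Proof. by move=> dr; split => //=; apply: is_derive_cst. Qed.

Lemma cderiv_sum (I : Type) (s : seq I) (z : I -> R -> C) t (v : I -> C) :
  (forall i, cderiv (z i) t (v i)) ->
  cderiv (fun x => \sum_(i <- s) z i x) t (\sum_(i <- s) v i).
Proof.
move=> dz; elim: s => [|i s IH].
  by rewrite big_nil; under eq_fun do rewrite big_nil; exact: cderiv_cst.
by rewrite big_cons; under eq_fun do rewrite big_cons; exact: cderivD.
Qed.

Lemma velocity_eq p q (c : R -> 'M[C]_(p, q)) t v w :
  has_velocity c t v -> v = w -> has_velocity c t w.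
Proof. by move=> h <-. Qed.

Lemma velocity_cst p q (A : 'M[C]_(p, q)) t : has_velocity (cst A) t 0.
Proof. by apply/has_velocityP => i j; rewrite mxE; apply: cderiv_cst. Qed.

Lemma velocityD p q (c d : R -> 'M[C]_(p, q)) t v w :
  has_velocity c t v -> has_velocity d t w ->
  has_velocity (fun s => c s + d s) t (v + w).
Proof.
move=> /has_velocityP dc /has_velocityP dd; apply/has_velocityP => i j.
by rewrite mxE; under eq_fun do rewrite mxE; exact: cderivD.
Qed.

Lemma velocityM p q r (c : R -> 'M[C]_(p, q)) (d : R -> 'M[C]_(q, r)) t v w :
  has_velocity c t v -> has_velocity d t w ->
  has_velocity (fun s => c s *m d s) t (v *m d t + c t *m w).
Proof.
move=> /has_velocityP dc /has_velocityP dd; apply/has_velocityP => i j.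
under eq_fun do rewrite mxE.
apply: cderiv_eq (cderiv_sum _ (fun k => cderivM (dc i k) (dd k j))) _.
by rewrite big_split /= !mxE.
Qed.

Lemma velocityMl p q r (A : 'M[C]_(p, q)) (d : R -> 'M[C]_(q, r)) t w :
  has_velocity d t w -> has_velocity (fun s => A *m d s) t (A *m w).
Proof.
move=> dd; apply: velocity_eq (velocityM (velocity_cst A t) dd) _.
by rewrite mul0mx add0r.
Qed.

Lemma velocityMr p q r (A : 'M[C]_(q, r)) (c : R -> 'M[C]_(p, q)) t v :
  has_velocity c t v -> has_velocity (fun s => c s *m A) t (v *m A).
Proof.
move=> dc; apply: velocity_eq (velocityM dc (velocity_cst A t)) _.
by rewrite mulmx0 addr0.
Qed.

Lemma velocity_adj p q (c : R -> 'M[C]_(p, q)) t v :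
  has_velocity c t v -> has_velocity (fun s => (c s)^t*) t (v^t* ).
Proof.
move=> /has_velocityP dc; apply/has_velocityP => i j.
by rewrite !mxE; under eq_fun do rewrite !mxE; exact: cderiv_conj.
Qed.

Lemma velocity_sum p q (I : finType) (c : I -> R -> 'M[C]_(p, q)) t v :
  (forall i, has_velocity (c i) t (v i)) ->
  has_velocity (fun s => \sum_i c i s) t (\sum_i v i).
Proof.
move=> dc; apply/has_velocityP => i j.
rewrite summxE; under eq_fun do rewrite summxE.
by apply: cderiv_sum => k; have /has_velocityP := dc k; apply.
Qed.

Lemma velocity_near p q (c d : R -> 'M[C]_(p, q)) t v :
  (\forall s \near t, c s = d s) -> has_velocity c t v -> has_velocity d t v.
Proof.
by move=> cd; apply: near_eq_is_derive; near do congr realmx; apply: filterS cd.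
Unshelve. all: end_near. Qed.

Lemma realmx_inj p q : injective (@realmx R p q).
Proof. exact: can_inj (@realmxK R p q). Qed.

Lemma velocity_uniq p q (c : R -> 'M[C]_(p, q)) t v w :
  has_velocity c t v -> has_velocity c t w -> v = w.
Proof. by move=> [_ e1] [_ e2]; apply: realmx_inj; rewrite -[LHS]e1 -[RHS]e2. Qed.

Lemma velocity0_cst p q (c : R -> 'M[C]_(p, q)) :
  (forall t, has_velocity c t 0) -> forall t, c t = c 0.
Proof.
move=> dc t; apply/matrixP => i j.
apply: complex_eqP.
  apply: (@is_derive_0_is_cst R (fun s => complex.Re (c s i j))) => s.
  by have /has_velocityP/(_ i j)[] := dc s; rewrite mxE.
apply: (@is_derive_0_is_cst R (fun s => complex.Im (c s i j))) => s.
by have /has_velocityP/(_ i j)[] := dc s; rewrite mxE.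
Qed.

End Velocity.

(** * The group SU(1,1) *)

Section SplitQuaternions.
Variable R : realType.
Local Notation C := R[i].
Local Notation conj := (@Num.conj C).
Implicit Types a c : C.

(** These matrices form the real algebra of split quaternions; SU(1,1) is
    its group of elements of norm one and su(1,1) its traceless part. *)
Definition su a c : 'M[C]_(1 + 1) :=
  block_mx a%:M (conj c)%:M c%:M (conj a)%:M.

(** The determinant of [su a c], which is also minus the form defining
    S^{2,1}. *)
Definition unorm a c : C := a * conj a - c * conj c.

Definition ent00 (M : 'M[C]_(1 + 1)) : C := ulsubmx M 0 0.
Definition ent10 (M : 'M[C]_(1 + 1)) : C := dlsubmx M 0 0.

Lemma ent00_su a c : ent00 (su a c) = a.
Proof. by rewrite /ent00 block_mxKul mxE eqxx. Qed.

Lemma ent10_su a c : ent10 (su a c) = c.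
Proof. by rewrite /ent10 block_mxKdl mxE eqxx. Qed.

Lemma scalar_mx_add p (x y : C) : (x + y)%:M = x%:M + y%:M :> 'M[C]_p.
Proof. exact: raddfD. Qed.

Lemma block_scalar_mul (a b c d a' b' c' d' : C) :
  block_mx a%:M b%:M c%:M d%:M *m block_mx a'%:M b'%:M c'%:M d'%:M =
  block_mx (a * a' + b * c')%:M (a * b' + b * d')%:M (c * a' + d * c')%:M
     (c * b' + d * d')%:M :> 'M[C]_(1 + 1).
Proof. by rewrite mulmx_block -!scalar_mxM -!scalar_mx_add. Qed.

Lemma block_scalar_inj (a b c d a' b' c' d' : C) :
  block_mx a%:M b%:M c%:M d%:M = block_mx a'%:M b'%:M c'%:M d'%:M :> 'M[C]_(1 + 1) ->
  [/\ a = a', b = b', c = c' & d = d'].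
Proof.
move=> /eq_block_mx[/matrixP/(_ 0 0) + /matrixP/(_ 0 0) + /matrixP/(_ 0 0) + /matrixP/(_ 0 0)].
by rewrite !mxE eqxx !mulr1n.
Qed.

Lemma block_scalarE (M : 'M[C]_(1 + 1)) : exists a b c d,
  M = block_mx a%:M b%:M c%:M d%:M.
Proof.
exists (ulsubmx M 0 0), (ursubmx M 0 0), (dlsubmx M 0 0), (drsubmx M 0 0).
by rewrite -!mx11_scalar submxK.
Qed.

Lemma suM a c a' c' :
  su a c *m su a' c' = su (a * a' + conj c * c') (c * a' + conj a * c').
Proof.
rewrite /su block_scalar_mul !conj_add !conj_mul !conjCK.
by congr block_mx; congr _%:M; ring.
Qed.

Lemma suD a c a' c' : su a c + su a' c' = su (a + a') (c + c').
Proof. by rewrite /su add_block_mx !conj_add -!scalar_mx_add. Qed.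

Lemma suZ (r : R) a c : r%:C *: su a c = su (r%:C * a) (r%:C * c).
Proof.
rewrite /su scale_block_mx !scale_scalar_mx !conj_mul.
by have -> : conj r%:C = r%:C by apply: conjc_real.
Qed.

Lemma su_adj a c : (su a c)^t* = su (conj a) c.
Proof. by rewrite /su adj_block !adj_scalar !conjCK. Qed.

Lemma su1 : su 1 0 = 1%:M.
Proof. by rewrite /su conjC0 conjC1 !raddf0 -scalar_mx_block. Qed.

Lemma su0 : su 0 0 = 0.
Proof. by rewrite /su conjC0 !raddf0 block_mx0. Qed.

Lemma su_mulV a c : unorm a c = 1 -> su (conj a) (- c) *m su a c = 1%:M.
Proof.
rewrite /unorm => ac; rewrite suM -su1; congr su; last by rewrite conjCK; ring.
by rewrite conj_opp -ac; ring.
Qed.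

Lemma unormV a c : unorm (conj a) (- c) = unorm a c.
Proof. by rewrite /unorm conjCK conj_opp; ring. Qed.

Lemma su_mulrV a c : unorm a c = 1 -> su a c *m su (conj a) (- c) = 1%:M.
Proof. by move=> ac; rewrite -[in su a c](conjCK a) -[in su _ c](opprK c) su_mulV ?unormV. Qed.

Lemma unormM a c a' c' :
  unorm (a * a' + conj c * c') (c * a' + conj a * c') = unorm a c * unorm a' c'.
Proof. by rewrite /unorm !conj_add !conj_mul !conjCK; ring. Qed.

Lemma unorm10 : unorm 1 0 = 1.
Proof. by rewrite /unorm conjC1 conjC0 !mulr0 mulr1 subr0. Qed.

Lemma Lam11E : Lam R 1 1 = block_mx (- 1)%:M (0 : C)%:M 0%:M 1%:M.
Proof. by rewrite /Lam !raddf0 raddfN. Qed.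

Lemma det2 (M : 'M[C]_(1 + 1)) : \det M =
  M (lshift 1 0) (lshift 1 0) * M (rshift 1 0) (rshift 1 0) -
  M (lshift 1 0) (rshift 1 0) * M (rshift 1 0) (lshift 1 0).
Proof.
have l0 (i j : 'I_(1 + 1)) (k : 'I_1) : i = 1 - j -> lift j k = i.
  by move=> ->; apply/val_inj; case: j k => [[|[|]]] // ? [[]].
rewrite (expand_det_row _ (lshift 1 0)) big_split_ord /= !big_ord1 /cofactor.
rewrite !det_mx11 !mxE (l0 (rshift 1 0)) ?(l0 (lshift 1 0)) //; try exact/val_inj.
by rewrite expr0 expr1; ring.
Qed.

Lemma det_block_scalar (a b c d : C) :
  \det (block_mx a%:M b%:M c%:M d%:M : 'M[C]_(1 + 1)) = a * d - b * c.
Proof.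
by rewrite det2 block_mxEul block_mxEdr block_mxEur block_mxEdl !mxE eqxx !mulr1n.
Qed.

Lemma SU11_su a c : SU11 (su a c) <-> unorm a c = 1.
Proof.
split=> [[_]|ac]; first by rewrite det_block_scalar => <-; rewrite /unorm; ring.
split; last by rewrite det_block_scalar -ac /unorm; ring.
have [su_unit _] := mulmx1_unit (su_mulrV ac).
split; first exact: su_unit.
rewrite su_adj Lam11E /su conjCK !block_scalar_mul.
congr (block_mx _%:M _%:M _%:M _%:M); first [ring | rewrite -[in RHS]ac /unorm; ring].
Qed.

(** Comparing the inverse given by the form with the adjugate shows that the
    second column is determined by the first. *)
Lemma SU11P q : SU11 q <-> exists a c, q = su a c /\ unorm a c = 1.
Proof.
split=> [|[a [c [-> ac]]]]; last exact/SU11_su.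
have [a [b [c [d ->]]]] := block_scalarE q.
move=> [[_]]; rewrite det_block_scalar adj_block !adj_scalar Lam11E.
rewrite !block_scalar_mul => /block_scalar_inj[e1 e2 e3 e4] e5.
have n1 : unorm a c = 1.
  by rewrite /unorm -[1]opprK -e1; ring.
(* [d - conj a] and [b - conj c] are both multiples of the off-diagonal
   entry of the Hermitian identity, because [unorm a c = det = 1]. *)
have ed : d = conj a.
  rewrite -[d]mul1r -n1 -[RHS]mul1r -e5 /unorm.
  apply/eqP; rewrite -subr_eq0.
  have -> : (a * conj a - c * conj c) * d - (a * d - b * c) * conj a =
     - c * (conj a * -1 * b + conj c * 1 * d) by ring.
  move: e2; rewrite !mulr0 !addr0 !add0r => ->; by rewrite mulr0.
have eb : b = conj c.
  rewrite -[b]mul1r -n1 -[RHS]mul1r -e5 /unorm.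
  apply/eqP; rewrite -subr_eq0.
  have -> : (a * conj a - c * conj c) * b - (a * d - b * c) * conj c =
     - a * (conj a * -1 * b + conj c * 1 * d) by ring.
  move: e2; rewrite !mulr0 !addr0 !add0r => ->; by rewrite mulr0.
by exists a, c; split; rewrite // /su ed eb.
Qed.

End SplitQuaternions.

(** * The diagonal copy of SU(1,1) in U(n,m) *)

Section Amplification.
Variable R : realType.
Local Notation C := R[i].
Local Notation conj := (@Num.conj C).
Variables (n m : nat) (Y : 'M[C]_(m, n)).
Hypothesis YY : Y^t* *m Y = 1%:M.

(** The adjoint of the isometric inclusion of C^{1,1} as the span of [(e_i,
    0)] and [(0, Y e_i)]. *)
Definition frame (i : 'I_n) : 'M[C]_(1 + 1, n + m) :=
  block_mx (delta_mx 0 i) 0 0 (delta_mx 0 i *m Y^t*).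

(** The simultaneous action on the [n] orthogonal copies of C^{1,1}, i.e.
    [M] tensored with the identity of C^n; [amp 1] is the projection on
    their sum. *)
Definition amp (M : 'M[C]_(1 + 1)) : 'M[C]_(n + m) :=
  \sum_i (frame i)^t* *m M *m frame i.

(** The affine extension of [amp] by the identity on the orthogonal
    complement of the copies. *)
Definition emb (M : 'M[C]_(1 + 1)) : 'M[C]_(n + m) := amp M + (1%:M - amp 1%:M).

(** The restriction of an operator to the [i]-th copy, a linear left inverse
    of both [amp] and [emb]. *)
Definition compress (i : 'I_n) (Q : 'M[C]_(n + m)) : 'M[C]_(1 + 1) :=
  frame i *m Q *m (frame i)^t*.

Lemma adj_delta p q (i : 'I_p) (j : 'I_q) :
  (delta_mx i j : 'M[C]_(p, q))^t* = delta_mx j i.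
Proof. by rewrite trmx_delta map_delta_mx. Qed.

Lemma adj_frame i : (frame i)^t* =
  block_mx (delta_mx i 0) 0 0 (Y *m delta_mx i 0) :> 'M[C]_(n + m, 1 + 1).
Proof. by rewrite /frame adj_block !trmx0 !map_mx0 adjmxM adjmxK !adj_delta. Qed.

Lemma frame_orthonormal i j : frame i *m (frame j)^t* = (i == j)%:R%:M.
Proof.
rewrite adj_frame /frame mulmx_block !mulmx0 !mul0mx !addr0 add0r.
rewrite mulmxA -(mulmxA _ (Y^t*)) YY mulmx1 !mul_delta_mx_cond.
rewrite scalar_mx_block; case: eqP => _ /=; last by rewrite !mulr0n !raddf0.
by rewrite !mulr1n; congr block_mx; apply/matrixP => k l; rewrite !ord1 !mxE !eqxx.
Qed.

Lemma ampD M N : amp (M + N) = amp M + amp N.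
Proof.
rewrite /amp -big_split; apply: eq_bigr => i _ /=.
by rewrite mulmxDr mulmxDl.
Qed.

Lemma ampZ z M : amp (z *: M) = z *: amp M.
Proof.
rewrite /amp scaler_sumr; apply: eq_bigr => i _.
by rewrite -scalemxAr -scalemxAl.
Qed.

Lemma amp0 : amp 0 = 0.
Proof. by rewrite -(scale0r 0) ampZ scale0r. Qed.

Lemma ampN M : amp (- M) = - amp M.
Proof. by rewrite -scaleN1r ampZ scaleN1r. Qed.

Lemma ampM M N : amp M *m amp N = amp (M *m N).
Proof.
rewrite /amp mulmx_suml; apply: eq_bigr => i _; rewrite mulmx_sumr (bigD1 i) //=.
rewrite big1 ?addr0 => [|j ji].
  rewrite !mulmxA -(mulmxA _ (frame i)) frame_orthonormal eqxx mulmx1.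
  by rewrite -!mulmxA.
rewrite !mulmxA -(mulmxA _ (frame i)) frame_orthonormal eq_sym (negPf ji).
by rewrite raddf0 mulmx0 !mul0mx.
Qed.

Lemma amp_adj M : (amp M)^t* = amp (M^t*).
Proof.
rewrite /amp adj_sum; apply: eq_bigr => i _.
by rewrite !adjmxM adjmxK mulmxA.
Qed.

Lemma amp_tr M : \tr (amp M) = n%:R * \tr M.
Proof.
rewrite /amp raddf_sum /= (eq_bigr (fun=> \tr M)) => [|i _].
  by rewrite sumr_const card_ord mulr_natl.
by rewrite mxtrace_mulC mulmxA frame_orthonormal eqxx mul1mx.
Qed.

Lemma embM M N : emb M *m emb N = emb (M *m N).
Proof.
have Ker1 A : amp A *m (1%:M - amp 1%:M) = 0.
  by rewrite mulmxBr mulmx1 ampM mulmx1 subrr.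
have Ker2 A : (1%:M - amp 1%:M) *m amp A = 0.
  by rewrite mulmxBl mul1mx ampM mul1mx subrr.
rewrite /emb mulmxDl (mulmxDr (amp M)) (mulmxDr (1%:M - _)) ampM Ker1 Ker2 addr0 add0r.
rewrite mulmxBr mulmx1.
by rewrite Ker2 subr0.
Qed.

Lemma emb_adj M : (emb M)^t* = emb (M^t*).
Proof. by rewrite /emb !adjmxD adjmxN !amp_adj !adjmx1. Qed.

Lemma emb1 : emb 1%:M = 1%:M.
Proof. by rewrite /emb subrKC. Qed.

Lemma emb_amp M N : emb M *m amp N = amp (M *m N).
Proof. by rewrite /emb mulmxDl mulmxBl mul1mx !ampM mul1mx subrr addr0. Qed.

Lemma amp_emb M N : amp M *m emb N = amp (M *m N).
Proof. by rewrite /emb mulmxDr mulmxBr mulmx1 !ampM mulmx1 subrr addr0. Qed.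

Lemma compress_amp i M : compress i (amp M) = M.
Proof.
rewrite /compress /amp mulmx_sumr mulmx_suml (bigD1 i) //= big1 ?addr0 => [|j ji].
  rewrite !mulmxA frame_orthonormal eqxx mul1mx.
  by rewrite -mulmxA frame_orthonormal eqxx mulmx1.
by rewrite !mulmxA frame_orthonormal eq_sym (negPf ji) raddf0 !mul0mx.
Qed.

Lemma compressD i Q Q' : compress i (Q + Q') = compress i Q + compress i Q'.
Proof. by rewrite /compress mulmxDr mulmxDl. Qed.

Lemma compress_emb i M : compress i (emb M) = M.
Proof.
rewrite /emb !compressD compress_amp.
have -> : compress i (- amp 1%:M) = - 1%:M.
  by rewrite -ampN compress_amp.
have -> : compress i 1%:M = 1%:M by rewrite /compress mulmx1 frame_orthonormal eqxx.
by rewrite subrr addr0.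
Qed.

Lemma sum_block (I : finType) p q r s (A : I -> 'M[C]_(p, q)) (B : I -> 'M[C]_(p, r))
    (D : I -> 'M[C]_(s, q)) (F : I -> 'M[C]_(s, r)) :
  \sum_i block_mx (A i) (B i) (D i) (F i) =
  block_mx (\sum_i A i) (\sum_i B i) (\sum_i D i) (\sum_i F i).
Proof.
apply/matrixP => k l; rewrite summxE.
by case: (split_ordP k) => k' ->; case: (split_ordP l) => l' ->;
  rewrite ?(block_mxEul, block_mxEur, block_mxEdl, block_mxEdr) summxE;
  apply: eq_bigr => i _; rewrite ?(block_mxEul, block_mxEur, block_mxEdl, block_mxEdr).
Qed.

Lemma mul_diag_block p q r s p' q' (A : 'M[C]_(p, q)) (B : 'M[C]_(r, s)) a b c d
    (A' : 'M[C]_(q, p')) (B' : 'M[C]_(s, q')) :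
  block_mx A 0 0 B *m block_mx a b c d *m block_mx A' 0 0 B' =
  block_mx (A *m a *m A') (A *m b *m B') (B *m c *m A') (B *m d *m B').
Proof. by rewrite !mulmx_block !mul0mx !mulmx0 !addr0 !add0r. Qed.

Lemma amp_block (a b c d : C) : amp (block_mx a%:M b%:M c%:M d%:M) =
  block_mx a%:M (b *: Y^t*) (c *: Y) (d *: (Y *m Y^t*)).
Proof.
pose D i : 'M[C]_n := delta_mx i i.
have DE i : (delta_mx i 0 : 'M[C]_(n, 1)) *m delta_mx 0 i = D i by exact: mul_delta_mx.
rewrite /amp (eq_bigr (fun i => block_mx (a *: D i) (b *: (D i *m Y^t*))
   (c *: (Y *m D i)) (d *: (Y *m D i *m Y^t*)))) => [|i _].
  rewrite sum_block -!scaler_sumr -!mulmx_suml -!mulmx_sumr -mx1_sum_delta.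
  by rewrite mul1mx !mulmx1 scalemx1.
rewrite adj_frame /frame mul_diag_block.
by congr block_mx; rewrite -?mulmxA mul_scalar_mx -?scalemxAr ?mulmxA -?(mulmxA Y) DE.
Qed.

Lemma amp_su a c : amp (su a c) =
  block_mx a%:M (conj c *: Y^t*) (c *: Y) (conj a *: (Y *m Y^t*)).
Proof. exact: amp_block. Qed.

(** On the complement of the copies, which lies in the positive part, the
    form of signature (n,m) is the identity; this is why [emb] preserves the
    forms. *)
Lemma emb_Lam : emb (Lam R 1 1) = Lam R n m.
Proof.
rewrite /emb Lam11E -[X in _ - amp X](su1 R) amp_su amp_block.
rewrite conjC0 conjC1 !scale0r !scale1r (scalar_mx_block n m) opp_block_mx !add_block_mx.
by rewrite !oppr0 !addr0 subrr addr0 subrKC raddfN.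
Qed.

Lemma emb_su a c : emb (su a c) = block_mx a%:M (conj c *: Y^t*) (c *: Y)
  (conj a *: (Y *m Y^t*) + (1%:M - Y *m Y^t*)).
Proof.
rewrite /emb -[X in _ - amp X](su1 R) !amp_su conjC0 conjC1 !scale0r scale1r.
by rewrite (scalar_mx_block n m) opp_block_mx !add_block_mx subrr !oppr0 !addr0.
Qed.

Lemma hat_su c : hat (c *: Y) = amp (su 0 c).
Proof. by rewrite amp_su conjC0 scale0r raddf0 /hat adjmxZ. Qed.

End Amplification.

(** * U(n) x U(m) and its cosets *)

Section Groups.
Variable R : realType.
Local Notation C := R[i].
Variables (n m : nat).
Local Notation mat := 'M[C]_(n + m).
Local Notation G := (@Unm R n m).
Local Notation H := (@UxU R n m).
Implicit Types g h : mat.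

Lemma unitaryP p (A : 'M[C]_p) : Un A <-> A *m A^t* = 1%:M.
Proof. by split=> /unitarymxP. Qed.

Lemma UnV p (A : 'M[C]_p) : Un A -> A^t* *m A = 1%:M.
Proof. by move=> /unitaryP/mulmx1C. Qed.

Lemma Un_adj p (A : 'M[C]_p) : Un A -> Un (A^t* ).
Proof. by move=> uA; apply/unitaryP; rewrite adjmxK; apply: UnV. Qed.

Lemma Un_mul p (A B : 'M[C]_p) : Un A -> Un B -> Un (A *m B).
Proof.
move=> /unitaryP uA /unitaryP uB; apply/unitaryP.
by rewrite adjmxM mulmxA -(mulmxA A) uB mulmx1.
Qed.

Lemma Un1 p : Un (1%:M : 'M[C]_p).
Proof. by apply/unitaryP; rewrite adjmx1 mulmx1. Qed.

Lemma diag_block_mul p q (A A' : 'M[C]_p) (B B' : 'M[C]_q) :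
  block_mx A 0 0 B *m block_mx A' 0 0 B' = block_mx (A *m A') 0 0 (B *m B').
Proof. by rewrite mulmx_block !mul0mx !mulmx0 !addr0 !add0r. Qed.

Lemma adj_diag_block p q (A : 'M[C]_p) (B : 'M[C]_q) :
  (block_mx A 0 0 B)^t* = block_mx (A^t* ) 0 0 (B^t* ).
Proof. by rewrite adj_block !trmx0 !map_mx0. Qed.

Lemma UxU_diag (A : 'M[C]_n) (B : 'M[C]_m) : Un A -> Un B -> H (block_mx A 0 0 B).
Proof. by move=> uA uB; exists A; [exact: uA | exists B; [exact: uB | reflexivity]]. Qed.

Lemma UxU_adj h : H h -> H (h^t* ).
Proof.
move=> [A uA [B uB <-]]; rewrite adj_diag_block.
exact: UxU_diag (Un_adj uA) (Un_adj uB).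
Qed.

Lemma UxU_mul h k : H h -> H k -> H (h *m k).
Proof.
move=> [A uA [B uB <-]] [A' uA' [B' uB' <-]]; rewrite diag_block_mul.
exact: UxU_diag (Un_mul uA uA') (Un_mul uB uB').
Qed.

Lemma UxU1 : H 1%:M.
Proof.
by rewrite scalar_mx_block; exact: UxU_diag (Un1 _) (Un1 _).
Qed.

Lemma UxU_mulVr h : H h -> h *m h^t* = 1%:M.
Proof.
move=> [A /unitaryP uA [B /unitaryP uB <-]].
by rewrite adj_diag_block diag_block_mul uA uB -scalar_mx_block.
Qed.

Lemma UxU_mulVl h : H h -> h^t* *m h = 1%:M.
Proof. by move=> /UxU_mulVr/mulmx1C. Qed.

Lemma UxU_block (A : 'M[C]_n) (B : 'M[C]_m) :
  block_mx A 0 0 B *m (block_mx A 0 0 B)^t* = 1%:M -> H (block_mx A 0 0 B).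
Proof.
rewrite adj_diag_block diag_block_mul scalar_mx_block => /eq_block_mx[uA _ _ uB].
by apply: UxU_diag; exact/unitaryP.
Qed.

Lemma UxU_Lam h : H h -> Lam R n m *m h = h *m Lam R n m.
Proof.
move=> [A _ [B _ <-]]; rewrite !diag_block_mul !mulmx1 !mul1mx.
by rewrite mulmxN mulNmx mulmx1 mul1mx.
Qed.

Lemma Unm_mul g h : G g -> G h -> G (g *m h).
Proof.
move=> [ug Lg] [uh Lh]; split; first by rewrite unitmx_mul ug uh.
rewrite adjmxM.
have -> : h^t* *m g^t* *m Lam R n m *m (g *m h) = h^t* *m (g^t* *m Lam R n m *m g) *m h.
  by rewrite !mulmxA.
by rewrite Lg Lh.
Qed.

Lemma UxU_Unm h : H h -> G h.
Proof.
move=> Hh; split; first by have [] := mulmx1_unit (UxU_mulVr Hh).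
by rewrite -mulmxA UxU_Lam // mulmxA UxU_mulVl // mul1mx.
Qed.

Lemma prD_mul g h : H h -> prD (g *m h) = prD g.
Proof.
move=> Hh; apply/seteqP; split=> x [k Hk <-].
  by exists (h *m k); [exact: UxU_mul|rewrite mulmxA].
exists (h^t* *m k); first by apply: UxU_mul => //; exact: UxU_adj.
by rewrite mulmxA -(mulmxA g) UxU_mulVr // mulmx1.
Qed.

Lemma prD_in g : prD g g.
Proof. by exists 1%:M; [exact: UxU1|rewrite mulmx1]. Qed.

(** A representative belongs to its own coset, so equal cosets share it. *)
Lemma prD_eq g g' : prD g = prD g' -> exists2 h, H h & g' = g *m h.
Proof.
move=> e; have [h Hh <-] : prD g g' by rewrite e; exact: prD_in.
by exists h.
Qed.

Lemma cancel_unit g (x y : mat) : g \in unitmx -> g *m x = g *m y -> x = y.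
Proof. by move=> ug e; rewrite -(mulKmx ug x) e mulKmx. Qed.

End Groups.

(** * Restricting the embedding to SU(1,1) and to its maximal torus *)

Section EmbeddedGroup.
Variable R : realType.
Local Notation C := R[i].
Local Notation conj := (@Num.conj C).
Variables (n m : nat) (Y : 'M[C]_(m, n)).
Hypothesis YY : Y^t* *m Y = 1%:M.
Local Notation mat := 'M[C]_(n + m).
Local Notation G := (@Unm R n m).
Local Notation H := (@UxU R n m).
Local Notation emb := (emb Y).
Local Notation amp := (amp Y).
Local Notation SU := (@SU11 R).

Lemma SU11_mul q r : SU q -> SU r -> SU (q *m r).
Proof.
move=> /SU11P[a [c [-> ac]]] /SU11P[a' [c' [-> ac']]].
by rewrite suM; apply/SU11_su; rewrite unormM ac ac' mulr1.
Qed.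

Lemma SU11_1 : SU 1%:M.
Proof. by rewrite -su1; apply/SU11_su/unorm10. Qed.

Lemma SU11_inv q : SU q -> exists r, [/\ SU r, r *m q = 1%:M & q *m r = 1%:M].
Proof.
move=> /SU11P[a [c [-> ac]]]; exists (su (conj a) (- c)).
by split; [apply/SU11_su; rewrite unormV|exact: su_mulV|exact: su_mulrV].
Qed.

Lemma SU11_diag (u : C) : u * conj u = 1 -> SU (su u 0).
Proof. by move=> uu; apply/SU11_su; rewrite /unorm uu mul0r subr0. Qed.

Lemma emb_Unm q : SU q -> G (emb q).
Proof.
move=> SUq; have [[_ Lq] _] := SUq; have [r [_ rq qr]] := SU11_inv SUq.
have Eqr : emb q *m emb r = 1%:M by rewrite (embM YY) qr emb1.
have [uq _] := mulmx1_unit Eqr.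
split; first exact: uq.
by rewrite emb_adj -(emb_Lam Y) (embM YY) (embM YY) Lq.
Qed.

(** The image is block diagonal and unitary, because [emb] commutes with
    adjoints. *)
Lemma emb_diag (u : C) : u * conj u = 1 -> H (emb (su u 0)).
Proof.
move=> uu.
have UU : emb (su u 0) *m (emb (su u 0))^t* = 1%:M.
  rewrite emb_adj (embM YY) su_adj suM -(emb1 Y) -su1; congr emb.
  by rewrite uu conjC0 !mul0r mulr0 !addr0.
by move: UU; rewrite emb_su conjC0 !scale0r => /UxU_block.
Qed.

(** The lower left block of [emb (su a c)] is [c *: Y], and [Y] is
    injective. *)
Lemma emb_H_diag q (i0 : 'I_n) : SU q -> H (emb q) -> exists2 u, q = su u 0 & u * conj u = 1.
Proof.
move=> /SU11P[a [c [-> ac]]] [A _ [B _]].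
rewrite emb_su => /eq_block_mx[_ _ /esym e _].
have c0 : c = 0.
  have /matrixP/(_ i0 i0) : Y^t* *m (c *: Y) = 0 by rewrite e mulmx0.
  by rewrite -scalemxAr YY !mxE eqxx mulr1.
by exists a; [rewrite c0|rewrite -ac /unorm c0 mul0r subr0].
Qed.

Lemma SU1U1P k : @SU1U1 R k <-> exists2 u, k = su u 0 & u * conj u = 1.
Proof.
split=> [[[A /unitaryP + [B /unitaryP + <-]]]|[u -> uu]].
  rewrite (mx11_scalar A) (mx11_scalar B) !adj_scalar -!scalar_mxM.
  move: (A 0 0) (B 0 0) => a b /matrixP/(_ 0 0); rewrite !mxE eqxx !mulr1n => aa.
  move=> /matrixP/(_ 0 0); rewrite !mxE eqxx !mulr1n => bb.
  rewrite -[X in block_mx _ X](raddf0 (@scalar_mx C 1)).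
  rewrite -[X in block_mx _ _ X](raddf0 (@scalar_mx C 1)).
  rewrite det_block_scalar mul0r subr0 => ab; exists a => //.
  rewrite /su conjC0; congr block_mx; congr _%:M.
  by rewrite -[LHS]mul1r -aa mulrAC ab mul1r.
split; last by rewrite det_block_scalar uu conjC0 mul0r subr0.
rewrite /su conjC0 raddf0; apply: UxU_diag; apply/unitaryP;
  by rewrite adj_scalar -scalar_mxM ?conjCK -?uu // mulrC.
Qed.

End EmbeddedGroup.

(** * Polar decomposition in SU(1,1) *)

Section PolarDecomposition.
Variable R : realType.
Local Notation C := R[i].
Local Notation conj := (@Num.conj C).
Implicit Types a c b : C.

(** The squared modulus, kept real-valued. *)
Definition sqn b : R := complex.Re b ^+ 2 + complex.Im b ^+ 2.

Lemma sqnE b : (sqn b)%:C = b * conj b.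
Proof. by case: b => x y; apply: complex_eqP => /=; rewrite /sqn /=; ring. Qed.

Lemma sqn_ge0 b : 0 <= sqn b.
Proof. by rewrite addr_ge0 ?sqr_ge0. Qed.

Lemma conj_real (r : R) : conj r%:C = r%:C.
Proof. exact: conjc_real. Qed.

Lemma unorm_sqn a c : unorm a c = (sqn a - sqn c)%:C.
Proof. by rewrite /unorm -!sqnE rmorphB. Qed.

Lemma unorm1P a c : unorm a c = 1 <-> sqn a = 1 + sqn c.
Proof.
rewrite unorm_sqn; split=> [/complexI e|->]; last by rewrite addrK.
by rewrite -e subrK.
Qed.

(** The positive square root of a positive matrix [N] of determinant one: by
    Cayley-Hamilton it is [(N + 1) / sqrt (tr N + 2)], and [tr N] is twice
    its first entry on the matrices concerned. *)
Definition polar (N : 'M[C]_(1 + 1)) : 'M[C]_(1 + 1) :=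
  (rsqrt (2 * (complex.Re (ent00 N) + 1)))%:C *: (N + 1%:M).

Lemma rsqrtV_sqr (x : R) : 0 <= x -> rsqrt (4 * x ^+ 2) = (2 * x)^-1.
Proof.
move=> x0; rewrite /rsqrt; congr (_^-1).
have -> : 4 * x ^+ 2 = (2 * x) ^+ 2 by ring.
by rewrite sqrtr_sqr ger0_norm // mulr_ge0.
Qed.

(** The positive square root of [q q^*] differs from [q] by a unitary matrix
    on the right, which here is the inverse phase of the first entry. *)
Lemma polar_sqr a c : unorm a c = 1 ->
  let u := ((Num.sqrt (sqn a))^-1)%:C * conj a in
  u * conj u = 1 /\ polar (su a c *m (su a c)^t* ) = su a c *m su u 0.
Proof.
move=> ac; have ac1 := ac; move/unorm1P: ac1 => ac1; set s := Num.sqrt (sqn a); move=> u.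
have r0 : 0 < sqn a by rewrite ac1 ltr_pwDl // sqn_ge0.
have s0 : 0 < s by rewrite sqrtr_gt0.
have ss : s ^+ 2 = sqn a by rewrite sqr_sqrtr // ltW.
pose P := s%:C.
have P0 : P != 0 by apply/eqP => /(@complexI _ s 0) e; rewrite e ltxx in s0.
have PP : P ^+ 2 = a * conj a by rewrite -sqnE -ss rmorphXn.
have VP : (s^-1)%:C = P^-1 by rewrite fmorphV.
have uE : u = P^-1 * conj a by rewrite /u VP.
have cP : conj P^-1 = P^-1 by rewrite -VP conj_real.
split.
  rewrite uE conj_mul conjCK cP.
  have -> : P^-1 * conj a * (P^-1 * a) = P ^- 2 * (a * conj a) by field.
  by rewrite -PP mulVf // expf_neq0.
have NE : su a c *m (su a c)^t* = su (sqn a + sqn c)%:C (2 * (c * conj a)).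
  by rewrite su_adj suM rmorphD /= !sqnE; congr su; ring.
rewrite /polar NE ent00_su /= ac1 -su1 suD suZ suM.
have -> : 2 * (1 + sqn c + sqn c + 1) = 4 * s ^+ 2 by rewrite ss ac1; ring.
rewrite rsqrtV_sqr ?ltW // fmorphV rmorphM /= rmorph_nat -/P !mulr0 !addr0.
congr su.
  have -> : (1 + sqn c + sqn c)%:C + 1 = 2 * P ^+ 2.
    by rewrite -rmorphXn /= ss ac1; apply: complex_eqP => /=; ring.
  have -> : a * u = P by rewrite uE mulrCA -PP; field.
  by field.
by rewrite uE; field.
Qed.

Lemma polar_sqr_pos (r : R) c : 0 <= r -> unorm r%:C c = 1 ->
  polar (su r%:C c *m (su r%:C c)^t* ) = su r%:C c.
Proof.
move=> r0 rc; have [_ ->] := polar_sqr rc.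
have rE : Num.sqrt (sqn r%:C) = r.
  by rewrite /sqn /= expr0n addr0 sqrtr_sqr ger0_norm.
rewrite rE conj_real -rmorphM /= mulVf ?su1 ?mulmx1 //.
apply/eqP => e; move/unorm1P: rc; rewrite e /sqn /= !expr0n /= addr0 => /eqP.
by rewrite eq_sym gt_eqF // ltr_pwDl // addr_ge0 ?sqr_ge0.
Qed.

(** The positive elements of SU(1,1), parametrized by the lower left entry;
    they represent the points of SU(1,1) / S(U(1) x U(1)) bijectively. *)
Definition boost b := su (Num.sqrt (1 + sqn b))%:C b.

Lemma sqn1_gt0 b : 0 < 1 + sqn b.
Proof. by rewrite ltr_pwDl // sqn_ge0. Qed.

Lemma boost_SU11 b : SU11 (boost b).
Proof.
apply/SU11_su/unorm1P; rewrite {1}/sqn /= expr0n addr0 sqr_sqrtr //.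
exact/ltW/sqn1_gt0.
Qed.

Lemma polar_boost b : polar (boost b *m (boost b)^t* ) = boost b.
Proof. by apply: polar_sqr_pos; [exact: sqrtr_ge0|apply/SU11_su/boost_SU11]. Qed.

Section SmoothBoost.
Context {E : normedModType R}.
Variables (U : set E) (Uo : open U).

Lemma csmooth_sqn (z : E -> C) : csmooth U z -> forall k, Ck k U (fun x => sqn (z x)).
Proof.
move=> Cz k; have [z1 z2] := Cz k.
by apply: (Ck_ext Uo _ (CkD Uo (CkM Uo z1 z1) (CkM Uo z2 z2))) => x _ /=.
Qed.

Lemma Ck_sqrt k (f : E -> R) :
  (forall x, U x -> 0 < f x) -> Ck k U f -> Ck k U (fun x => Num.sqrt (f x)).
Proof.
move=> f0 Cf; apply: (Ck_ext Uo _ (CkM Uo Cf (Ck_rsqrt Uo f0 Cf))) => x Ux /=.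
rewrite /rsqrt -{1}(sqr_sqrtr (ltW (f0 x Ux))) expr2 -mulrA divff ?mulr1 //.
by rewrite gt_eqF // sqrtr_gt0 f0.
Qed.

Lemma csmooth_ent00 (F : E -> 'M[C]_(1 + 1)) : mxsmooth U F -> csmooth U (fun x => ent00 (F x)).
Proof.
move=> CF; apply: csmooth_ext (CF (lshift 1 0) (lshift 1 0)) => x.
by rewrite /ent00 !mxE.
Qed.

Lemma csmooth_ent10 (F : E -> 'M[C]_(1 + 1)) : mxsmooth U F -> csmooth U (fun x => ent10 (F x)).
Proof.
move=> CF; apply: csmooth_ext (CF (rshift 1 0) (lshift 1 0)) => x.
by rewrite /ent10 !mxE.
Qed.

Lemma mxsmooth_su (a c : E -> C) :
  csmooth U a -> csmooth U c -> mxsmooth U (fun x => su (a x) (c x)).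
Proof.
by move=> Ca Cc; apply: mxsmooth_block => //; apply: mxsmooth_scalar => //;
  apply: csmooth_conj.
Qed.

Lemma mxsmooth_boost (z : E -> C) : csmooth U z -> mxsmooth U (fun x => boost (z x)).
Proof.
move=> Cz; apply: mxsmooth_su => //; apply: csmooth_real => // k.
apply: Ck_sqrt => [x _|]; first exact: sqn1_gt0.
exact: (CkD Uo (Ck_cst Uo k _) (csmooth_sqn Cz k)).
Qed.

Lemma mxsmooth_polar (N : E -> 'M[C]_(1 + 1)) :
  (forall x, U x -> -1 < complex.Re (ent00 (N x))) -> mxsmooth U N ->
  mxsmooth U (fun x => polar (N x)).
Proof.
move=> N0 CN; apply: mxsmoothZ => //; last by apply: mxsmoothD => //; apply: mxsmooth_cst.
apply: csmooth_real => // k.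
have C2 : Ck k U (cst (2 : R)) by apply: Ck_cst.
have C1 : Ck k U (cst (1 : R)) by apply: Ck_cst.
apply: (Ck_rsqrt Uo _ (CkM Uo C2 (CkD Uo (csmooth_ent00 CN k).1 C1))) => x Ux /=.
by have := N0 x Ux; rewrite pmulr_rgt0 // => ?; lra.
Qed.

End SmoothBoost.
End PolarDecomposition.

(** * The disc and its global section *)

Section Disc.
Variable R : realType.
Local Notation C := R[i].
Local Notation conj := (@Num.conj C).
Variables (n m : nat) (Y : 'M[C]_(m, n)).
Hypothesis YY : Y^t* *m Y = 1%:M.
Variable i0 : 'I_n.
Local Notation mat := 'M[C]_(n + m).
Local Notation G := (@Unm R n m).
Local Notation H := (@UxU R n m).
Local Notation emb := (emb Y).
Local Notation amp := (amp Y).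
Local Notation SU := (@SU11 R).

(** The orbit of the origin under the embedded SU(1,1), a copy of the
    hyperbolic disc. *)
Definition disc : set (set mat) := @prD R n m @` (emb @` SU).

Lemma preD_disc g : preD disc g <-> exists q h, [/\ SU q, H h & g = emb q *m h].
Proof.
split=> [[_ [_ [q SUq <-] e]]|[q [h [SUq Hh ->]]]].
  have [h Hh ->] := prD_eq e; by exists q, h.
split; first by apply: Unm_mul; [exact: emb_Unm|exact: UxU_Unm].
by exists (emb q); [exists q|rewrite /= prD_mul].
Qed.

Lemma disc_Dnm : disc `<=` @Dnm R n m.
Proof. by move=> _ [_ [q SUq <-] <-]; exists (emb q) => //; exact: emb_Unm. Qed.

(** The positive square root on one copy of [g g^*], which depends on the
    coset of [g] only. *)
Definition polarD (g : mat) : 'M[C]_(1 + 1) := polar (compress Y i0 (g *m g^t* )).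

Lemma gramH (g h : mat) : H h -> (g *m h) *m (g *m h)^t* = g *m g^t*.
Proof. by move=> Hh; rewrite adjmxM mulmxA -(mulmxA g) UxU_mulVr // mulmx1. Qed.

Lemma polarDH (g h : mat) : H h -> polarD (g *m h) = polarD g.
Proof. by move=> Hh; rewrite /polarD gramH. Qed.

Lemma polarD_emb q h : SU q -> H h ->
  exists2 u, u * conj u = 1 & polarD (emb q *m h) = q *m su u 0.
Proof.
move=> /SU11P[a [c [-> ac]]] Hh; rewrite polarDH // /polarD.
have [uu e] := polar_sqr ac.
exists (((Num.sqrt (sqn a))^-1)%:C * conj a) => //.
by rewrite emb_adj (embM YY) (compress_emb YY) e.
Qed.

Lemma polarD_boost b h : H h -> polarD (emb (boost b) *m h) = boost b.
Proof.
move=> Hh; rewrite polarDH // /polarD.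
by rewrite emb_adj (embM YY) (compress_emb YY) polar_boost.
Qed.

(** The positive representative of a point of [disc], obtained smoothly and
    without choices: this is a global section. *)
Lemma polarD_disc g : preD disc g ->
  SU (polarD g) /\ prD (emb (polarD g)) = prD g.
Proof.
move=> /preD_disc[q [h [SUq Hh ->]]]; have [u uu ->] := polarD_emb SUq Hh.
split; first by apply: SU11_mul => //; exact: SU11_diag.
by rewrite -(embM YY) prD_mul ?prD_mul //; exact: emb_diag.
Qed.

(** A positive element of SU(1,1) is determined by its lower left entry,
    which is therefore a global complex coordinate on [disc]. *)
Lemma polarD_disc_boost g : preD disc g -> polarD g = boost (ent10 (polarD g)).
Proof.
move=> /preD_disc[q [h [/SU11P[a [c [-> ac]]] Hh ->]]]; rewrite polarDH //.
rewrite /polarD emb_adj (embM YY) (compress_emb YY).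
have [uu ->] := polar_sqr ac; move: uu; set u := _ * conj a => uu.
have : SU (su a c *m su u 0) by apply: SU11_mul; [exact/SU11_su|exact: SU11_diag].
have ua : a * u = (Num.sqrt (sqn a))%:C.
  have s0 : Num.sqrt (sqn a) != 0.
    by move/unorm1P: ac => ->; rewrite gt_eqF // sqrtr_gt0 sqn1_gt0.
  rewrite /u mulrCA -sqnE -[X in _ * (X)%:C]sqr_sqrtr ?sqn_ge0 //.
  by rewrite -rmorphM /= expr2 mulKf.
rewrite suM mulr0 addr0 ua => SUe; rewrite ent10_su /boost; congr su.
by move/SU11_su/unorm1P: SUe => <-; rewrite /sqn /= expr0n addr0 sqrtr_sqr ger0_norm ?sqrtr_ge0.
Qed.

(** Smooth on all matrices and not only near [disc], because the diagonal
    entries of [g g^*] are nonnegative. *)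
Lemma mxsmooth_polarD (E : normedModType R) (U : set E) (F : E -> mat) :
  open U -> mxsmooth U F -> mxsmooth U (fun x => polarD (F x)).
Proof.
move=> Uo CF; apply: mxsmooth_polar => // [x _|]; last first.
  apply: mxsmoothM => //; last exact: mxsmooth_cst.
  apply: mxsmoothM => //; first exact: mxsmooth_cst.
  by apply: mxsmoothM => //; exact: mxsmooth_adj.
apply: (@lt_le_trans _ _ 0); first by rewrite ltrN10.
rewrite /compress; set W := frame Y i0 *m F x.
have -> : frame Y i0 *m (F x *m (F x)^t* ) *m (frame Y i0)^t* = W *m W^t*.
  by rewrite adjmxM !mulmxA.
have -> : ent00 (W *m W^t* ) = \sum_j (sqn (W (lshift 1 0) j))%:C.
  by rewrite /ent00 !mxE; apply: eq_bigr => j _; rewrite sqnE !mxE.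
rewrite -rmorph_sum /=; apply: sumr_ge0 => j _; exact: sqn_ge0.
Qed.

End Disc.

Section Cosets.
Variable R : realType.
Local Notation C := R[i].
Variables (n m : nat).
Local Notation mat := 'M[C]_(n + m).
Local Notation G := (@Unm R n m).
Local Notation H := (@UxU R n m).

(** An arbitrary representative of a coset; only functions invariant under
    the block-diagonal subgroup are applied to it. *)
Definition coset_rep (x : set mat) : mat := xget 0 x.

Lemma coset_repP (g : mat) : exists2 h, H h & coset_rep (prD g) = g *m h.
Proof.
have [h Hh e] : prD g (coset_rep (prD g)) by apply: xgetPex; exists g; exact: prD_in.
by exists h.
Qed.

Lemma smooth_from_D_rep (F : normedModType R) B (Psi : mat -> F) :
  (forall g h, preD B g -> H h -> Psi (g *m h) = Psi g) ->
  smooth_open setT (fun x => Psi (cplxmx x)) ->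
  smooth_from_D B (fun x => Psi (coset_rep x)).
Proof.
move=> PsiH CPsi x _; exists setT, (fun x => Psi (cplxmx x)); split=> // y.
move=> /realmx_image By _ /=; have [h Hh ->] := coset_repP (cplxmx y).
by rewrite PsiH.
Qed.

Lemma realmx_imageT p q : @realmx R p q @` setT = setT.
Proof. by rewrite realmx_imageE. Qed.

Lemma D_open_Dnm : D_open (@Dnm R n m).
Proof.
split=> //; exists setT; first by rewrite /cx_open realmx_imageT; exact: openT.
by rewrite setIT; apply/seteqP; split=> [g []|g Gg] //; split=> //; exists g.
Qed.

End Cosets.

(** * The disc is a connected surface *)

Section PolarAngle.
Variable R : realType.
Local Notation C := R[i].

Lemma polar_angle (x y : R) : x ^+ 2 + y ^+ 2 = 1 ->
  exists t, x = cos t /\ y = sin t.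
Proof.
move=> xy; have x1 : -1 <= x <= 1.
  rewrite -ler_norml -(@ler_pXn2r _ 2) ?nnegrE // expr1n real_normK ?num_real //.
  by rewrite -xy lerDl sqr_ge0.
have cx : cos (acos x) = x by rewrite acosK // in_itv.
have sx : sin (acos x) = `|y|.
  by rewrite sin_acos // -xy addrC addKr sqrtr_sqr.
have [y0|y0] := leP 0 y.
  by exists (acos x); rewrite cx sx ger0_norm.
by exists (- acos x); rewrite cosN sinN cx sx ltr0_norm // opprK.
Qed.

Lemma Ck_id k (U : set R) : open U -> Ck k U (fun t : R => t).
Proof. by move=> Uo; apply: (@Ck_lin R R U Uo R k idfun) => t; exact: cvg_id. Qed.

Lemma SU11_path q : @SU11 R q -> exists gam : R -> 'M[C]_(1 + 1),
  [/\ mxsmooth setT gam, forall t, SU11 (gam t), gam 0 = 1%:M & gam 1 = q].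
Proof.
move=> /SU11P[a [c [-> ac]]]; move/unorm1P: (ac) => ac1.
set s := Num.sqrt (1 + sqn c).
have s0 : s != 0 by rewrite gt_eqF // sqrtr_gt0 sqn1_gt0.
have ss : s ^+ 2 = 1 + sqn c by rewrite sqr_sqrtr // ltW ?sqn1_gt0.
(* Write [a = s * (cos th +i* sin th)]; the path rotates the phase from [0] to
   [th] while it scales [c] from [0] to its final value. *)
have [|th [cth sth]] := @polar_angle (complex.Re a / s) (complex.Im a / s).
  by rewrite !expr_div_n -mulrDl -[_ + _]/(sqn a) ac1 -ss divff // expf_neq0.
pose u (t : R) : C := cos (t * th) +i* sin (t * th).
pose r (t : R) := Num.sqrt (1 + sqn (t%:C * c)).
exists (fun t => su ((r t)%:C * u t) (t%:C * c)).
have oT : open (setT : set R) by exact: openT.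
have Ct : csmooth setT (fun t : R => t%:C).
  by apply: csmooth_real => // k; exact: Ck_id.
have Cu : csmooth setT u.
  move=> k; have C1 : Ck k setT (fun t : R => t * th).
    exact: (CkM oT (Ck_id k oT) (Ck_cst oT k th)).
  by have [] := Ck_cos_sin oT C1.
have uu t : u t * Num.conj (u t) = 1 by rewrite -sqnE /sqn /= cos2Dsin2.
have Ctc : csmooth setT (fun t : R => t%:C * c).
  by apply: csmoothM => //; exact: csmooth_cst.
split.
- apply: mxsmooth_su => //; apply: csmoothM => //; apply: csmooth_real => // k.
  apply: Ck_sqrt => // [t _|]; first exact: sqn1_gt0.
  exact: (CkD oT (Ck_cst oT k _) (csmooth_sqn oT Ctc k)).
- move=> t; apply/SU11_su; rewrite /unorm conj_mul conj_real mulrACA uu mulr1.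
  rewrite -sqnE -rmorphM -rmorphB /= -expr2 sqr_sqrtr ?addrK //.
  exact/ltW/sqn1_gt0.
- rewrite mul0r /u mul0r cos0 sin0 /r mul0r /sqn /= !expr0n !addr0 sqrtr1.
  by rewrite mul1r su1.
- rewrite mul1r /u mul1r -cth -sth /r mul1r -/s; congr su.
  by apply: complex_eqP => /=; rewrite mul0r ?subr0 ?addr0 mulrC divfK.
Qed.

End PolarAngle.

Section DiscStructure.
Variable R : realType.
Local Notation C := R[i].
Local Notation conj := (@Num.conj C).
Variables (n m : nat) (Y : 'M[C]_(m, n)).
Hypothesis YY : Y^t* *m Y = 1%:M.
Variable i0 : 'I_n.
Local Notation mat := 'M[C]_(n + m).
Local Notation G := (@Unm R n m).
Local Notation H := (@UxU R n m).
Local Notation emb := (emb Y).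
Local Notation amp := (amp Y).
Local Notation SU := (@SU11 R).
Local Notation disc := (disc Y).
Local Notation polarD := (polarD Y i0).

(** The image is the union of the images of paths through the identity. *)
Lemma SU11_image_connected p q (Phi : 'M[C]_(1 + 1) -> 'M[C]_(p, q)) :
  (forall gam : R -> 'M[C]_(1 + 1), mxsmooth setT gam -> mxsmooth setT (Phi \o gam)) ->
  cx_connected (Phi @` SU).
Proof.
move=> PhiC; rewrite /cx_connected.
pose I := {gam : R -> 'M[C]_(1 + 1) |
  [/\ mxsmooth setT gam, forall t, SU (gam t) & gam 0 = 1%:M]}.
pose A (g : I) := (fun t => realmx (Phi (sval g t))) @` `[0, 1]%classic.
have -> : @realmx R p q @` (Phi @` SU) = \bigcup_(g in [set: I]) A g.
  apply/seteqP; split=> [_ [_ [x SUx <-] <-]|_ [[gam [Cg SUg g0]] _ [t _ <-]]].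
    have [gam [Cg SUg g0 g1]] := SU11_path SUx.
    exists (exist _ gam (And3 Cg SUg g0)) => //.
    by exists 1; [rewrite /= in_itv /= ler01 lexx|rewrite /= g1].
  by exists (Phi (gam t)) => //; exists (gam t).
apply: bigcup_connected.
  exists (realmx (Phi 1%:M)) => -[gam [Cg SUg g0]] _.
  by exists 0; [rewrite /= in_itv /= ler01 lexx|rewrite /= g0].
move=> [gam [Cg SUg g0]] _.
apply: connected_continuous_connected; first exact: segment_connected.
apply: continuous_subspaceT => t.
have [_ /(_ 0)] := smooth_open_realmx openT (PhiC _ Cg).
by apply.
Qed.

Lemma mxsmooth_emb (E : normedModType R) (U : set E) (F : E -> 'M[C]_(1 + 1)) :
  open U -> mxsmooth U F -> mxsmooth U (fun x => emb (F x)).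
Proof.
move=> Uo CF; apply: mxsmoothD => //; last exact: mxsmooth_cst.
apply: mxsmooth_sum => // i.
apply: mxsmoothM => //; last exact: mxsmooth_cst.
by apply: mxsmoothM => //; exact: mxsmooth_cst.
Qed.

Lemma mxsmooth_compress (E : normedModType R) (U : set E) (F : E -> mat) :
  open U -> mxsmooth U F -> mxsmooth U (fun x => compress Y i0 (F x)).
Proof.
move=> Uo CF; apply: mxsmoothM => //; last exact: mxsmooth_cst.
by apply: mxsmoothM => //; exact: mxsmooth_cst.
Qed.

(** Open sets of cosets are pulled back to open sets of matrices, where the
    connectedness of the image of SU(1,1) applies. *)
Lemma disc_connected : D_connected disc.
Proof.
move=> W1 W2 [_ [V1 oV1 e1]] [_ [V2 oV2 e2]] cover meet1 meet2.
set K := @realmx R _ _ @` (emb @` SU).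
have cK : connected K.
  by apply: SU11_image_connected => gam Cg; apply: mxsmooth_emb => //; exact: openT.
have inO (W : set (set mat)) (O : set mat) q : preD W = G `&` O -> SU q ->
    O (emb q) <-> W (prD (emb q)).
  move=> e SUq.
  have Gq : G (emb q) by exact: emb_Unm.
  split=> [Oq|Wq]; first by have [_ Wq] : preD W (emb q) by rewrite e.
  by have [_ Oq] : (G `&` O) (emb q) by rewrite -e.
have KE x : K x -> exists2 q, SU q & cplxmx x = emb q.
  by move=> [_ [q SUq <-] <-]; exists q => //; rewrite realmxK.
apply: contrapT => W12.
have no12 q : SU q -> V1 (emb q) -> V2 (emb q) -> False.
  move=> SUq O1q O2q; apply: W12; exists (prD (emb q)); split; first split.
  - by exists (emb q) => //; exists q.
  - by apply/(inO _ _ _ e1).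
  - by apply/(inO _ _ _ e2).
have pick W O (e : preD W = G `&` O) : disc `&` W !=set0 -> exists2 q, SU q & O (emb q).
  by move=> [_ [[_ [q SUq <-] <-] Wq]]; exists q => //; apply/(inO _ _ _ e).
have [q1 SUq1 O1q1] := pick _ _ e1 meet1.
have [q2 SUq2 O2q2] := pick _ _ e2 meet2.
pose B := K `&` (@realmx R _ _ @` V1).
have inK q : SU q -> K (realmx (emb q)) by move=> SUq; exists (emb q) => //; exists q.
have : B = K.
  apply: cK.
  - by exists (realmx (emb q1)); split; [exact: inK|exists (emb q1)].
  - by exists (@realmx R _ _ @` V1).
  - exists (~` (@realmx R _ _ @` V2)); first exact: open_closedC.
    apply/seteqP; split=> x [Kx]; have [q SUq xq] := KE _ Kx.
      move=> /realmx_image; rewrite xq => O1q; split=> //.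
      by move=> /realmx_image; rewrite xq; exact: no12.
    move=> nO2; split=> //; apply/realmx_image; rewrite xq.
    have : disc (prD (emb q)) by exists (emb q) => //; exists q.
    move=> /cover[/(inO _ _ _ e1)|/(inO _ _ _ e2)]; first exact.
    by move=> O2q; case: nO2; apply/realmx_image; rewrite xq; exact: O2q.
move=> BK; have : B (realmx (emb q2)) by rewrite BK; exact: inK.
move=> [_ /realmx_image]; rewrite realmxK => O1q2; exact: no12 O1q2 O2q2.
Qed.

Lemma disc_submanifold : D_submanifold 2 disc.
Proof.
split=> [|s ds]; first exact: disc_Dnm.
pose z (u : 'rV[R]_2) : C := u 0 0 +i* u 0 1.
pose phi u := @prD R n m (emb (boost (z u))).
pose Psi (g : mat) : 'rV[R]_2 := \row_(j < 2)
  if j == 0 then complex.Re (ent10 (polarD g)) else complex.Im (ent10 (polarD g)).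
exists (@Dnm R n m), setT, phi, (fun x => Psi (coset_rep x)).
have zPsi g : z (Psi g) = ent10 (polarD g).
  by apply: complex_eqP; rewrite /z !mxE.
split.
- by split; [exact: D_open_Dnm|exact: (disc_Dnm YY ds)].
- exact: openT.
- split.
    move=> u _; exists setT, (fun u => emb (boost (z u))); split=> //.
      apply: smooth_open_realmx; first exact: openT.
      apply: mxsmooth_emb; first exact: openT.
      apply: mxsmooth_boost => [|k]; first exact: openT.
      by split; apply: Ck_coord; exact: openT.
    move=> y _ _; split; last by [].
    by apply: (emb_Unm YY); exact: boost_SU11.
  apply: smooth_from_D_rep => [g h _ Hh|].
    by rewrite /Psi (polarDH _ _ _ Hh).
  apply: smooth_open_rowmx; first exact: openT.
  move=> j k.
  have Cp : csmooth setT (fun x => ent10 (polarD (cplxmx x))).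
    apply: csmooth_ent10; apply: mxsmooth_polarD; first exact: openT.
    by apply: mxsmooth_cplxmx; exact: openT.
  have [C1 C2] := Cp k; have [->|j0] := eqVneq j 0.
    by apply: (Ck_ext openT _ C1) => x _; rewrite mxE.
  by apply: (Ck_ext openT _ C2) => x _; rewrite mxE (negPf j0).
- move=> u _; split.
    have SUb := boost_SU11 (z u).
    split; first by exists (emb (boost (z u))); [exists (boost (z u))|].
    by exists (emb (boost (z u))); [exact: (emb_Unm YY)|].
  have [h Hh ->] := coset_repP (emb (boost (z u))).
  apply/rowP => j; rewrite mxE polarD_boost // ent10_su.
  by case: j => [[|[|]]] //= ?; congr (u _ _); exact: val_inj.
- move=> x [dx _]; split=> //; rewrite /phi zPsi.
  case: dx => [g [q SUq <-] <-].
  have [h Hh e] := coset_repP (emb q).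
  have dg : preD disc (coset_rep (prD (emb q))).
    by rewrite e; apply/preD_disc => //; exists q, h.
  rewrite -(polarD_disc_boost YY i0 dg).
  have [_ ed] := polarD_disc YY i0 dg.
  by rewrite ed e (prD_mul _ Hh).
Qed.

End DiscStructure.

(** * Tangent vectors of SU(1,1) *)

Section Tangents.
Variable R : realType.
Local Notation C := R[i].
Local Notation conj := (@Num.conj C).
Variables (n m : nat) (Y : 'M[C]_(m, n)).
Hypothesis YY : Y^t* *m Y = 1%:M.
Variable i0 : 'I_n.
Local Notation mat := 'M[C]_(n + m).
Local Notation G := (@Unm R n m).
Local Notation H := (@UxU R n m).
Local Notation emb := (emb Y).
Local Notation amp := (amp Y).
Local Notation SU := (@SU11 R).
Local Notation disc := (disc Y).

Lemma velocity_amp (c : R -> 'M[C]_(1 + 1)) t v :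
  has_velocity c t v -> has_velocity (fun s => amp (c s)) t (amp v).
Proof. by move=> dc; apply: velocity_sum => i; apply: velocityMr; apply: velocityMl. Qed.

Lemma velocity_emb (c : R -> 'M[C]_(1 + 1)) t v :
  has_velocity c t v -> has_velocity (fun s => emb (c s)) t (amp v).
Proof.
move=> dc; apply: velocity_eq (velocityD (velocity_amp dc) (velocity_cst _ t)) _.
exact: addr0.
Qed.

Lemma velocity_compress (c : R -> mat) t v :
  has_velocity c t v -> has_velocity (fun s => compress Y i0 (c s)) t (compress Y i0 v).
Proof. by move=> dc; apply: velocityMr; apply: velocityMl. Qed.

Lemma velocity_su (a c : R -> C) t a' c' : cderiv a t a' -> cderiv c t c' ->
  has_velocity (fun s => su (a s) (c s)) t (su a' c').
Proof.
move=> da dc; have sc (z : R -> C) z' : cderiv z t z' ->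
    forall i j : 'I_1, cderiv (fun s => (z s)%:M i j) t (z'%:M i j).
  move=> dz i j; rewrite !ord1 mxE eqxx mulr1n.
  by under eq_fun do rewrite mxE eqxx mulr1n.
apply/has_velocityP => i j.
case: (split_ordP i) => i' ->; case: (split_ordP j) => j' ->.
- by rewrite block_mxEul; under eq_fun do rewrite block_mxEul; exact: sc.
- by rewrite block_mxEur; under eq_fun do rewrite block_mxEur; apply: sc; exact: cderiv_conj.
- by rewrite block_mxEdl; under eq_fun do rewrite block_mxEdl; exact: sc.
- by rewrite block_mxEdr; under eq_fun do rewrite block_mxEdr; apply: sc; exact: cderiv_conj.
Qed.

Lemma cderiv_ent00 (c : R -> 'M[C]_(1 + 1)) t v :
  has_velocity c t v -> cderiv (fun s => ent00 (c s)) t (ent00 v).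
Proof.
move=> /has_velocityP/(_ (lshift 1 0) (lshift 1 0)); rewrite /ent00 !mxE.
by under [X in _ -> cderiv X _ _]eq_fun do rewrite !mxE.
Qed.

Lemma cderiv_ent10 (c : R -> 'M[C]_(1 + 1)) t v :
  has_velocity c t v -> cderiv (fun s => ent10 (c s)) t (ent10 v).
Proof.
move=> /has_velocityP/(_ (rshift 1 0) (lshift 1 0)); rewrite /ent10 !mxE.
by under [X in _ -> cderiv X _ _]eq_fun do rewrite !mxE.
Qed.

(** The entries of [c t] satisfy the real linear relations of [su]
    identically, so the velocity has this form too; the trace condition
    comes from differentiating the preserved form. *)
Lemma SU11_velocity (c : R -> 'M[C]_(1 + 1)) v :
  (\forall t \near (0 : R), SU (c t)) -> has_velocity c 0 v ->
  exists al ga, complex.Re al = 0 /\ v = c 0 *m su al ga.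
Proof.
move=> SUc dc; have /SU11P[a [b [q0 ab]]] := nbhs_singleton SUc.
have vE : v = su (ent00 v) (ent10 v).
  apply: (velocity_uniq dc).
  apply: velocity_near (velocity_su (cderiv_ent00 dc) (cderiv_ent10 dc)).
  apply: filterS SUc => t /SU11P[x [y [-> _]]].
  by rewrite ent00_su ent10_su.
have [al [ga wE]] : exists al ga, su (conj a) (- b) *m v = su al ga.
  by rewrite vE suM; do 2!eexists.
exists al, ga; have vE2 : v = c 0 *m su al ga.
  by rewrite -wE q0 mulmxA su_mulrV // mul1mx.
split=> //.
have dL : has_velocity (fun t => (c t)^t* *m Lam R 1 1 *m c t) 0 0.
  apply: velocity_near (velocity_cst (Lam R 1 1) 0).
  by apply: filterS SUc => t [[_ e] _].
have := velocity_uniq dL (velocityM (velocityMr (Lam R 1 1) (velocity_adj dc)) dc).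
have [[_ L0] _] := nbhs_singleton SUc.
have e1 : v^t* *m Lam R 1 1 *m c 0 = (su al ga)^t* *m Lam R 1 1.
  by rewrite vE2 adjmxM -[in RHS]L0 !mulmxA.
have e2 : (c 0)^t* *m Lam R 1 1 *m v = Lam R 1 1 *m su al ga.
  by rewrite vE2 mulmxA L0.
rewrite e1 e2 su_adj Lam11E /su !block_scalar_mul add_block_mx -!scalar_mx_add.
rewrite -[X in X = _ -> _]su0 /su.
move=> /block_scalar_inj[e _ _ _].
move: e => /(congr1 (fun z : C => complex.Re z)).
rewrite !mulr0 mul0r !addr0 mulrN1 mulN1r cReD !cReN cReJ /=; lra.
Qed.

Definition unit_curve (y : R) (t : R) : C := cos (t * y) +i* sin (t * y).

Lemma unit_curveJ y t : unit_curve y t * conj (unit_curve y t) = 1.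
Proof. by rewrite -sqnE /sqn /= cos2Dsin2. Qed.

Definition SU11_curve (y : R) (ga : C) (t : R) : 'M[C]_(1 + 1) :=
  boost (t%:C * ga) *m su (unit_curve y t) 0.

Lemma SU11_curveP y ga : [/\ mxsmooth setT (SU11_curve y ga),
  forall t, SU (SU11_curve y ga t), SU11_curve y ga 0 = 1%:M &
  has_velocity (SU11_curve y ga) 0 (su (0 +i* y) ga)].
Proof.
have oT : open (setT : set R) by exact: openT.
have r0 : Num.sqrt (1 + sqn (0%:C * ga)) = 1.
  by rewrite mul0r /sqn /= !expr0n !addr0 sqrtr1.
have u0 : unit_curve y 0 = 1 by rewrite /unit_curve mul0r cos0 sin0.
split.
- apply: mxsmoothM => //.
    apply: mxsmooth_boost => //; apply: csmoothM => //; last exact: csmooth_cst.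
    by apply: csmooth_real => // k; exact: Ck_id.
  apply: mxsmooth_su => //; last exact: csmooth_cst.
  move=> k; have C1 : Ck k setT (fun t : R => t * y).
    exact: (CkM oT (Ck_id k oT) (Ck_cst oT k y)).
  by have [] := Ck_cos_sin oT C1.
- move=> t; apply: SU11_mul; first exact: boost_SU11.
  exact/SU11_diag/unit_curveJ.
- by rewrite /SU11_curve u0 /boost r0 mul0r su1 mulmx1.
- have did : is_derive (0 : R) (1 : R) (fun t : R => t) 1 by exact: is_derive_id.
  have dty : is_derive (0 : R) (1 : R) (fun t : R => t * y) y.
    by apply: is_derive_eq; rewrite /GRing.scale /= ?mulr1 ?mulr0 ?addr0 ?add0r.
  have du : cderiv (unit_curve y) 0 (0 +i* y).
    have := is_derive_cos (0 * y); have := is_derive_sin (0 * y) => ds dc.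
    split => /=.
      apply: (real_deriv_eq (@is_derive1_comp R cos (fun t => t * y) 0 _ _ dc dty)).
      by rewrite mul0r sin0 oppr0 mul0r.
    apply: (real_deriv_eq (@is_derive1_comp R sin (fun t => t * y) 0 _ _ ds dty)).
    by rewrite mul0r cos0 mul1r.
  have dtg : cderiv (fun t : R => t%:C * ga) 0 ga.
    apply: (cderiv_eq (cderivM (cderiv_real did) (cderiv_cst ga 0))).
    by rewrite mul1r mulr0 addr0.
  have dr : cderiv (fun t : R => (Num.sqrt (1 + sqn (t%:C * ga)))%:C) 0 0.
    apply: cderiv_real.
    have e : (fun t : R => 1 + sqn (t%:C * ga)) = (fun t : R => 1 + t ^+ 2 * sqn ga).
      apply/funext => t; congr (1 + _); case: (ga) => x z.
      by rewrite /sqn /= !mul0r subr0 addr0; ring.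
    have d1 : is_derive (0 : R) (1 : R) (fun t : R => 1 + sqn (t%:C * ga)) 0.
      rewrite e; apply: is_derive_eq.
      by rewrite !(scaler0, scale0r, addr0, mulr0).
    have := @is_derive1_sqrt R (1 + sqn (0%:C * ga)) (sqn1_gt0 _) => ds.
    have dsd1 := @is_derive1_comp R Num.sqrt (fun t => 1 + sqn (t%:C * ga)) 0 _ _ ds d1.
    by apply: (real_deriv_eq dsd1); rewrite mulr0.
  have := velocityM (velocity_su dr dtg) (velocity_su du (cderiv_cst 0 0)).
  move=> dsu; apply: (@velocity_eq _ _ _ (SU11_curve y ga) _ _ _ dsu); rewrite u0 r0 mul0r.
  by rewrite [cst 0 0]/(0 : C) !su1 mulmx1 mul1mx suD add0r addr0.
Qed.

End Tangents.

(** * Geodesics of the disc *)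

Section Geodesics.
Variable R : realType.
Local Notation C := R[i].
Local Notation conj := (@Num.conj C).
Variables (n m : nat) (Y : 'M[C]_(m, n)).
Hypothesis YY : Y^t* *m Y = 1%:M.
Variable i0 : 'I_n.
Local Notation mat := 'M[C]_(n + m).
Local Notation G := (@Unm R n m).
Local Notation H := (@UxU R n m).
Local Notation emb := (emb Y).
Local Notation amp := (amp Y).
Local Notation SU := (@SU11 R).
Local Notation disc := (disc Y).

Lemma near0W (P : R -> Prop) : (forall t, P t) -> \forall t \near (0 : R), P t.
Proof. by move=> Pt; apply: (@filterE _ (nbhs (0 : R))). Qed.

Lemma hat_adj (X : 'M[C]_(m, n)) : (hat X)^t* = hat X.
Proof. by rewrite /hat adj_block !trmx0 !map_mx0 adjmxK. Qed.

Lemma h_alg_adj (B : mat) : @h_alg R n m B -> B^t* = - B.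
Proof.
move=> [A eA [D eD <-]]; rewrite adj_diag_block opp_block_mx !oppr0.
by congr block_mx.
Qed.

Lemma UxU_conj_hat (h : mat) (X : 'M[C]_(m, n)) : H h ->
  exists Z, h *m hat X *m h^t* = hat Z.
Proof.
move=> [A _ [B _ <-]]; exists (B *m X *m A^t*).
rewrite adj_diag_block /hat mul_diag_block !mulmx0 !mul0mx.
by congr block_mx; rewrite !adjmxM adjmxK mulmxA.
Qed.

Lemma amp_hat (N : 'M[C]_(1 + 1)) Z : amp N = hat Z -> exists b, hat Z = amp (su 0 b).
Proof.
have [a [b [c [d ->]]]] := block_scalarE N.
rewrite amp_block /hat => /eq_block_mx[_ _ <- _].
by exists c; rewrite amp_su conjC0 scale0r raddf0 adjmxZ.
Qed.

(** Tangent vectors of the surface in an arbitrary frame [emb q *m h]: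
    differentiating [c c^*], which stays in the range of [emb], puts [2 g A
    g^*] in the range of [amp]. *)
Lemma D_tangent_disc_sub q h A : SU q -> H h -> D_tangent disc (emb q *m h) A ->
  exists b, h *m A *m h^t* = amp (su 0 b).
Proof.
move=> SUq Hh [[X _ XA] [c [B [hB [_ c0 cdisc dc]]]]].
have [r [_ rq qr]] := SU11_inv SUq.
set g := emb q *m h in dc c0.
set V := compress Y i0 ((g *m (A + B)) *m g^t* + g *m (g *m (A + B))^t* ).
have dQ := velocityM dc (velocity_adj dc).
(* [c c^*] stays in the range of [emb], hence is recovered from its compression. *)
have QE : \forall t \near (0 : R), emb (compress Y i0 (c t *m (c t)^t* )) = c t *m (c t)^t*.
  apply: filterS cdisc => t /(preD_disc YY)[q' [h' [_ Hh' ->]]].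
  by rewrite gramH // emb_adj (embM YY) (compress_emb YY).
have eV := velocity_uniq dQ (velocity_near QE (velocity_emb Y (velocity_compress Y i0 dQ))).
rewrite c0 -/V in eV.
have AE : A^t* = A by rewrite -XA hat_adj.
have BE := h_alg_adj hB.
have gAB : (g *m (A + B))^t* = (A - B) *m g^t* by rewrite adjmxM adjmxD AE BE.
have gE : h = emb r *m g by rewrite /g mulmxA (embM YY) rq emb1 mul1mx.
have hE : h^t* = g^t* *m (emb r)^t* by rewrite [in LHS]gE adjmxM.
have e2 : 2 *: (h *m A *m h^t* ) = amp (r *m V *m r^t* ).
  have -> : amp (r *m V *m r^t* ) = emb r *m amp V *m (emb r)^t*.
    by rewrite emb_adj (emb_amp YY) (amp_emb YY).
  rewrite -eV gAB.
  (* The skew part [B], tangent to the fibre, cancels. *)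
  have -> : g *m (A + B) *m g^t* + g *m ((A - B) *m g^t* ) = 2 *: (g *m A *m g^t* ).
    rewrite mulmxA -mulmxDl -mulmxDr addrACA subrr addr0 -mulr2n.
    by rewrite -scaler_nat -scalemxAr -scalemxAl.
  rewrite -scalemxAr -scalemxAl; congr (2 *: _).
  by rewrite hE {1}gE !mulmxA.
have [Z ZE] := UxU_conj_hat X Hh.
have hAh : h *m A *m h^t* = hat Z by rewrite -XA.
have : amp (2^-1 *: (r *m V *m r^t* )) = hat Z.
  by rewrite ampZ -e2 scalerA mulVf ?pnatr_eq0 ?scale1r ?hAh.
by move=> /amp_hat[b bE]; exists b; rewrite hAh.
Qed.

Lemma D_tangent_disc1 : D_tangent disc 1%:M = [set amp (su 0 b) | b in setT].
Proof.
apply/seteqP; split=> [A tA|_ [b _ <-]].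
  have := @D_tangent_disc_sub 1%:M 1%:M A (SU11_1 R) (UxU1 _ _ _).
  rewrite emb1 mul1mx => /(_ tA)[b].
  by rewrite adjmx1 mul1mx mulmx1 => ->; exists b.
split; first by exists (b *: Y) => //; exact: hat_su.
have [Cs SUs s0 ds] := SU11_curveP 0 b.
exists (fun t => emb (SU11_curve 0 b t)), 0; split.
  exists 0; first by rewrite /= trmx0 map_mx0 oppr0.
  exists 0; first by rewrite /= trmx0 map_mx0 oppr0.
  by rewrite block_mx0.
split.
- by apply: smooth_open_realmx; [exact: openT|apply: mxsmooth_emb => //; exact: openT].
- by rewrite s0 emb1.
- apply: near0W => t; apply/(preD_disc YY); exists (SU11_curve 0 b t), 1%:M.
  by split; [exact: SUs|exact: UxU1|rewrite mulmx1].
- apply: velocity_eq (velocity_emb Y ds) _; by rewrite addr0 mul1mx.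
Qed.

Definition ch (k t : R) := (expR (k * t) + expR (- k * t)) / 2.
Definition sh (k t : R) := (expR (k * t) - expR (- k * t)) / 2.

Lemma is_derive_expRM (k t : R) :
  is_derive t (1 : R) (fun s => expR (k * s)) (k * expR (k * t)).
Proof.
have dk : is_derive t (1 : R) (fun s : R => k * s) k.
  by apply: is_derive_eq; rewrite /GRing.scale /= ?mulr1 ?mulr0 ?addr0 ?add0r.
apply: (real_deriv_eq (@is_derive1_comp R expR (fun s => k * s) t _ _ (is_derive_expR _) dk)).
exact: mulrC.
Qed.

Lemma is_derive_ch k t : is_derive t (1 : R) (ch k) (k * sh k t).
Proof.
have [d1 d2] := (is_derive_expRM k t, is_derive_expRM (- k) t).
apply: (@real_deriv_eq _ _ _ ((2^-1 : R) *: (k * expR (k * t) + - k * expR (- k * t)))).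
  have -> : ch k = (2^-1 : R) \*: ((fun s => expR (k * s)) + (fun s => expR (- k * s))).
    by apply/funext => s; rewrite /ch mulrC.
  exact: is_deriveZ.
by rewrite /sh /GRing.scale /=; ring.
Qed.

Lemma is_derive_sh k t : is_derive t (1 : R) (sh k) (k * ch k t).
Proof.
have [d1 d2] := (is_derive_expRM k t, is_derive_expRM (- k) t).
apply: (@real_deriv_eq _ _ _ ((2^-1 : R) *: (k * expR (k * t) - - k * expR (- k * t)))).
  have -> : sh k = (2^-1 : R) \*: ((fun s => expR (k * s)) - (fun s => expR (- k * s))).
    by apply/funext => s; rewrite /sh mulrC.
  exact: is_deriveZ.
by rewrite /ch /GRing.scale /=; ring.
Qed.

Lemma ch2_sh2 k t : ch k t ^+ 2 - sh k t ^+ 2 = 1.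
Proof.
have e : expR (k * t) * expR (- k * t) = 1.
  by rewrite -expRD mulNr subrr expR0.
rewrite /ch /sh -[RHS]e.
by move: (expR (k * t)) (expR (- k * t)) => x y; field.
Qed.

(** The exponential of [t *: su 0 b]. For [b = 0] the quotient by [k = 0] is
    multiplied by [b], so the formula still holds. *)
Definition su_exp (b : C) (t : R) : 'M[C]_(1 + 1) :=
  let k := Num.sqrt (sqn b) in su (ch k t)%:C ((sh k t / k)%:C * b).

Lemma sqn_sqrt_eq0 (b : C) : Num.sqrt (sqn b) = 0 -> b = 0.
Proof.
move=> /eqP; rewrite sqrtr_eq0 => k0.
have e : sqn b = 0 by apply/eqP; rewrite eq_le k0 sqn_ge0.
move: e => /eqP; rewrite /sqn paddr_eq0 ?sqr_ge0 // !sqrf_eq0 => /andP[/eqP x0 /eqP y0].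
exact: complex_eqP.
Qed.

Lemma su_exp_velocity b t : has_velocity (su_exp b) t (su 0 b *m su_exp b t).
Proof.
rewrite /su_exp; set k := Num.sqrt (sqn b).
have kk : k ^+ 2 = sqn b by rewrite sqr_sqrtr // sqn_ge0.
have ds : is_derive t (1 : R) (fun s => sh k s / k) (k * ch k t / k).
  have -> : (fun s => sh k s / k) = k^-1 \*: sh k.
    by apply/funext => s; rewrite mulrC.
  apply: real_deriv_eq (is_deriveZ _ (is_derive_sh k t)) _.
  by rewrite /GRing.scale /= mulrC.
have dc := velocity_su (cderiv_real (is_derive_ch k t))
  (cderivM (cderiv_real ds) (cderiv_cst b t)).
apply: velocity_eq dc _.
rewrite suM mul0r add0r conjC0 mul0r addr0 mulr0 addr0.
have [k0|k0] := eqVneq k 0.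
  by rewrite (sqn_sqrt_eq0 k0) k0 !mulr0 !mul0r ?conjC0.
congr su; last by rewrite mulrC; congr (_ * (_)%:C); field.
rewrite [RHS](_ : _ = (sh k t / k)%:C * (b * conj b)); last by ring.
rewrite -sqnE -kk -rmorphM /=.
by congr (_%:C); field.
Qed.

Lemma su_exp_comm b t : su_exp b t *m su 0 b = su 0 b *m su_exp b t.
Proof.
rewrite /su_exp !suM !mulr0 !mul0r !conjC0 !mul0r !add0r !addr0 conj_mul !conj_real.
by congr su; ring.
Qed.

Lemma su_exp_SU11 b t : SU (su_exp b t).
Proof.
apply/SU11_su; rewrite /su_exp; set k := Num.sqrt (sqn b).
have kk : k ^+ 2 = sqn b by rewrite sqr_sqrtr // sqn_ge0.
rewrite /unorm conj_mul !conj_real mulrACA -sqnE -!rmorphM -rmorphB /= -kk.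
have [k0|k0] := eqVneq k 0.
  by rewrite k0 expr0n mulr0 subr0 /ch oppr0 !mul0r expR0 divff ?mulr1.
rewrite (_ : ch k t * ch k t - _ = 1) // -[RHS](ch2_sh2 k t); by field.
Qed.

Lemma su_expV b t : su_exp b t *m su_exp (- b) t = 1%:M.
Proof.
have SUe := su_exp_SU11 b t.
have kN : sqn (- b) = sqn b by rewrite /sqn cReN cImN !sqrrN.
have -> : su_exp (- b) t =
    su (conj (ent00 (su_exp b t))) (- ent10 (su_exp b t)).
  by rewrite /su_exp ent00_su ent10_su conj_real kN mulrN.
by move: SUe; rewrite {1}/su_exp => /SU11_su ?; rewrite /su_exp ent00_su ent10_su su_mulrV.
Qed.

Lemma su_expVl b t : su_exp (- b) t *m su_exp b t = 1%:M.
Proof. exact/mulmx1C/su_expV. Qed.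

Lemma su_exp0 b : su_exp b 0 = 1%:M.
Proof.
by rewrite /su_exp /ch /sh !mulr0 expR0 subrr !mul0r divff // su1.
Qed.

(** A geodesic is determined by its initial frame and velocity, since its
    frame solves a linear differential equation with constant coefficients. *)
Lemma geodesic_exp q h A b gam : SU q -> H h -> h *m A *m h^t* = amp (su 0 b) ->
  geodesic gam (emb q *m h) A ->
  forall t, gam t = prD (emb (q *m su_exp b t)).
Proof.
move=> SUq Hh hAh [c [A' [cP dA c0 A0 gamE]]] t.
have AE s : A' s = A by rewrite (velocity0_cst dA) A0.
have Ah : A *m h^t* = h^t* *m amp (su 0 b).
  by rewrite -hAh !mulmxA UxU_mulVl // mul1mx.
(* Uniqueness for [c' = c A]: the product with the inverse solution is constant. *)
pose k s := c s *m h^t* *m emb (su_exp (- b) s).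
have dk s : has_velocity k s 0.
  have [_ _ dc] := cP s.
  have := velocityM (velocityMr (h^t* ) dc) (velocity_emb Y (su_exp_velocity (- b) s)).
  move/velocity_eq; apply.
  rewrite AE -!(mulmxA (c s)) Ah -mulmxDr -!mulmxA -mulmxDr (amp_emb YY) -ampD -mulmxDl.
  by rewrite suD addr0 subrr su0 mul0mx amp0 !mulmx0.
have k0 : k 0 = emb q.
  by rewrite /k su_exp0 emb1 mulmx1 c0 -mulmxA UxU_mulVr // mulmx1.
have ct : c t = emb (q *m su_exp b t) *m h.
  rewrite -(embM YY) -k0 -(velocity0_cst dk t) /k -!mulmxA (mulmxA (emb _)) (embM YY).
  by rewrite su_expVl emb1 mul1mx UxU_mulVl // mulmx1.
by rewrite gamE ct prD_mul.
Qed.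

Lemma exp_geodesic q h A b : SU q -> H h -> @m_space R n m A ->
  h *m A *m h^t* = amp (su 0 b) ->
  geodesic (fun t => prD (emb (q *m su_exp b t))) (emb q *m h) A.
Proof.
move=> SUq Hh mA hAh; exists (fun t => emb (q *m su_exp b t) *m h), (cst A).
split; [move=> t|move=> t| |reflexivity|move=> t].
- have SUt : SU (q *m su_exp b t) by apply: SU11_mul => //; exact: su_exp_SU11.
  split; [|exact: mA|].
    by apply: Unm_mul; [exact: emb_Unm|exact: UxU_Unm].
  have hA : h *m A = amp (su 0 b) *m h.
    by rewrite -hAh -!mulmxA UxU_mulVl // mulmx1.
  apply: velocity_eq (velocityMr h (velocity_emb Y (velocityMl q (su_exp_velocity b t)))) _.
  rewrite -su_exp_comm -[RHS]mulmxA hA [RHS]mulmxA (emb_amp YY).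
  by congr (amp _ *m h); exact: mulmxA.
- exact: velocity_cst.
- by rewrite su_exp0 mulmx1.
- by rewrite prD_mul.
Qed.

Lemma disc_complete_totally_geodesic : complete_totally_geodesic 2 disc.
Proof.
have in_disc q : SU q -> disc (prD (emb q)) by move=> SUq; exists (emb q) => //; exists q.
split.
- exact: disc_connected.
- exact: disc_submanifold.
- move=> g A gam /(preD_disc YY)[q [h [SUq Hh ->]]] tA geo.
  have [b bE] := D_tangent_disc_sub SUq Hh tA.
  apply: near0W => t; rewrite (geodesic_exp SUq Hh bE geo).
  by apply: in_disc; apply: SU11_mul => //; exact: su_exp_SU11.
- move=> g A /(preD_disc YY)[q [h [SUq Hh ->]]] tA.
  have [b bE] := D_tangent_disc_sub SUq Hh tA.
  have mA : @m_space R n m A by case: tA.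
  exists (fun t => prD (emb (q *m su_exp b t))); first exact: exp_geodesic.
  by move=> t; apply: in_disc; apply: SU11_mul => //; exact: su_exp_SU11.
Qed.

End Geodesics.

(** * The left-invariant distribution *)

Section RealSpan.
Variable R : realType.
Local Notation C := R[i].
Variables p q : nat.
Implicit Types A V : set 'M[C]_(p, q).

Lemma real_span_min A V : V 0 -> (forall M N, V M -> V N -> V (M + N)) ->
  (forall (r : R) M, V M -> V (r%:C *: M)) -> A `<=` V -> real_span A `<=` V.
Proof.
move=> V0 VD VZ AV _ [k [c [B [AB ->]]]].
by apply: big_ind => // i _; apply: VZ; apply: AV.
Qed.

Lemma real_spanZ A M (r : R) : A M -> real_span A (r%:C *: M).
Proof. by move=> AM; exists 1%N, (fun=> r), (fun=> M); rewrite big_ord1. Qed.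

Lemma real_spanD A M N : real_span A M -> real_span A N -> real_span A (M + N).
Proof.
move=> [k [c [B [AB ->]]]] [k' [c' [B' [AB' ->]]]].
exists (k + k')%N.
exists (fun i => match fintype.split i with inl j => c j | inr j => c' j end).
exists (fun i => match fintype.split i with inl j => B j | inr j => B' j end).
split; first by move=> i; case: fintype.split.
rewrite big_split_ord /=; congr (_ + _); apply: eq_bigr => i _.
  by rewrite (unsplitK (inl i)).
by rewrite (unsplitK (inr i)).
Qed.

End RealSpan.

Section Distribution.
Variable R : realType.
Local Notation C := R[i].
Local Notation conj := (@Num.conj C).
Variables (n m : nat) (Y : 'M[C]_(m, n)).
Hypothesis YY : Y^t* *m Y = 1%:M.
Local Notation amp := (amp Y).

Lemma mprime_amp (r : R) : r != 0 ->
  mprime (r%:C *: Y) = [set amp (su 0 b) | b in setT].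
Proof.
move=> r0; apply/seteqP; split=> [|_ [b _ <-]].
  apply: real_span_min.
  - by exists 0; rewrite // su0 amp0.
  - by move=> _ _ [b _ <-] [c _ <-]; exists (b + c); rewrite // -ampD suD addr0.
  - by move=> s _ [b _ <-]; exists (s%:C * b); rewrite // -ampZ suZ mulr0.
  - move=> M [->|->]; rewrite ?scalerA hat_su; by eexists.
have -> : amp (su 0 b) = (complex.Re b / r)%:C *: hat (r%:C *: Y) +
    (complex.Im b / r)%:C *: hat ('i%C *: (r%:C *: Y)).
  rewrite scalerA !hat_su -!ampZ -ampD !suZ suD !mulr0 addr0; congr (amp (su _ _)).
  by apply: complex_eqP; rewrite !cReImE /=; field.
by apply: real_spanD; apply: real_spanZ; [left|right].
Qed.

(** The image of su(1,1): the constraint on the first entry says that the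
    trace vanishes. *)
Definition amp_su11 : set 'M[C]_(n + m) :=
  [set M | exists al ga, complex.Re al = 0 /\ M = amp (su al ga)].

Lemma bracket_amp M N : bracket (amp M) (amp N) = amp (bracket M N).
Proof. by rewrite /bracket !(ampM YY) ampD ampN. Qed.

Lemma bracket_su (b c : C) :
  bracket (su 0 b) (su 0 c) = su (conj b * c - conj c * b) 0.
Proof.
rewrite /bracket !suM -scaleN1r; have -> : -1 = (-1 : R)%:C by rewrite rmorphN1.
rewrite suZ suD !mul0r !mulr0 !add0r conjC0 !(mul0r, mulr0, addr0).
by rewrite rmorphN1 mulN1r.
Qed.

(** The bracket of the generators of m' spans the diagonal part of su(1,1),
    and su(1,1) is closed under brackets. *)
Lemma generated_distribution_amp (r : R) : r != 0 ->
  generated_distribution (mprime (r%:C *: Y)) = amp_su11.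
Proof.
move=> r0; rewrite /generated_distribution mprime_amp //.
apply/seteqP; split=> [|_ [al [ga [al0 ->]]]].
  apply: real_span_min.
  - by exists 0, 0; rewrite su0 amp0.
  - move=> _ _ [al [ga [al0 ->]]] [al' [ga' [al0' ->]]].
    exists (al + al'), (ga + ga'); rewrite -ampD suD; split=> //.
    by rewrite cReD al0 al0' addr0.
  - move=> s _ [al [ga [al0 ->]]]; exists (s%:C * al), (s%:C * ga).
    by rewrite -ampZ suZ cReM al0 /= mulr0 mul0r subr0.
  - move=> _ [[b _ <-]|[_ [b _ <-] [_ [c _ <-] <-]]]; first by exists 0, b.
    exists (conj b * c - conj c * b), 0; rewrite bracket_amp bracket_su; split=> //.
    by rewrite !cReImE; ring.
(* [hat Y, hat (iY)] equals [2 i] in the diagonal direction of su(1,1). *)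
have -> : amp (su al ga) = (1 : R)%:C *: amp (su 0 ga) +
    (complex.Im al / 2)%:C *: bracket (amp (su 0 1)) (amp (su 0 'i%C)).
  rewrite bracket_amp bracket_su -!ampZ -ampD !suZ suD.
  congr amp; congr su; last by rewrite mulr0 addr0 mul1r.
  by apply: complex_eqP; rewrite !cReImE /= ?al0; field.
apply: real_spanD; apply: real_spanZ; first by left; exists ga.
by right; exists (amp (su 0 1)); [exists 1|exists (amp (su 0 'i%C)); first by exists 'i%C].
Qed.

End Distribution.

Section Normalization.
Variable R : realType.
Local Notation C := R[i].

(** A diagonal entry of [X^* X] is a sum of squared moduli, so the scalar is
    positive and has a real square root. *)
Lemma Umn_isometry n m (X : 'M[C]_(m, n)) : (0 < n)%N -> Umn X ->
  exists (r : R) (Y : 'M[C]_(m, n)), [/\ r != 0, Y^t* *m Y = 1%:M & X = r%:C *: Y].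
Proof.
move=> n0 [lam [lam0 XX]]; pose i0 := Ordinal n0.
pose s := \sum_k sqn (X k i0).
have s_ge0 : 0 <= s by apply: sumr_ge0 => k _; exact: sqn_ge0.
have lamE : lam = s%:C.
  have /matrixP/(_ i0 i0) := XX; rewrite !mxE eqxx mulr1n => <-.
  rewrite /s rmorph_sum; apply: eq_bigr => k _ /=.
  by rewrite sqnE !mxE mulrC.
have r0 : Num.sqrt s != 0.
  rewrite sqrtr_eq0 -ltNge lt_def s_ge0 andbT.
  by apply: contra_neq lam0 => s0; rewrite lamE s0.
have rC0 : (Num.sqrt s)%:C != 0 :> C by apply: contra_neq r0 => /complexI.
exists (Num.sqrt s), ((Num.sqrt s)^-1%:C *: X); split=> //.
  rewrite adjmxZ -scalemxAl -scalemxAr XX conj_real scalerA scale_scalar_mx lamE.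
  by rewrite -!rmorphM /= -expr2 -[X in _ * X]sqr_sqrtr // -exprMn mulVf // expr1n.
by rewrite scalerA -rmorphM mulfV // scale1r.
Qed.

End Normalization.

(** * The circle bundle over a translate of the disc *)

Section Bundle.
Variable R : realType.
Local Notation C := R[i].
Local Notation conj := (@Num.conj C).
Variables (n m : nat) (Y : 'M[C]_(m, n)).
Hypothesis YY : Y^t* *m Y = 1%:M.
Variable i0 : 'I_n.
Local Notation mat := 'M[C]_(n + m).
Local Notation G := (@Unm R n m).
Local Notation H := (@UxU R n m).
Local Notation emb := (emb Y).
Local Notation amp := (amp Y).
Local Notation SU := (@SU11 R).
Local Notation disc := (disc Y).
Variable a : mat.
Hypothesis Ga : G a.

Definition orbit_map (q : 'M[C]_(1 + 1)) : mat := a *m emb q.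
Definition bundle : set mat := orbit_map @` SU.
(** Undoes the translation and compresses to one copy: a linear left inverse
    of [orbit_map]. *)
Definition pull (g : mat) : 'M[C]_(1 + 1) := compress Y i0 (invmx a *m g).

Lemma a_unit : a \in unitmx. Proof. by case: Ga. Qed.

Lemma pull_orbit q : pull (orbit_map q) = q.
Proof. by rewrite /pull /orbit_map (mulKmx a_unit) (compress_emb YY). Qed.

Lemma orbit_mapM q r : orbit_map (q *m r) = orbit_map q *m emb r.
Proof. by rewrite /orbit_map -(embM YY) mulmxA. Qed.

Lemma orbit_map_amp q M : orbit_map q *m amp M = a *m amp (q *m M).
Proof. by rewrite /orbit_map -mulmxA (emb_amp YY). Qed.

Lemma orbit_map_Unm q : SU q -> G (orbit_map q).
Proof. by move=> SUq; apply: Unm_mul; [exact: Ga|exact: emb_Unm]. Qed.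

Lemma mxsmooth_orbit (E : normedModType R) (U : set E) (F : E -> 'M[C]_(1 + 1)) :
  open U -> mxsmooth U F -> mxsmooth U (fun x => orbit_map (F x)).
Proof.
move=> Uo CF; apply: mxsmoothM => //; first exact: mxsmooth_cst.
exact: mxsmooth_emb.
Qed.

Lemma mxsmooth_pull (E : normedModType R) (U : set E) (F : E -> mat) :
  open U -> mxsmooth U F -> mxsmooth U (fun x => pull (F x)).
Proof.
move=> Uo CF; apply: mxsmooth_compress => //.
by apply: mxsmoothM => //; exact: mxsmooth_cst.
Qed.

Lemma velocity_orbit (c : R -> 'M[C]_(1 + 1)) t v :
  has_velocity c t v -> has_velocity (fun s => orbit_map (c s)) t (a *m amp v).
Proof. by move=> dc; apply: velocityMl; exact: velocity_emb. Qed.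

Lemma open_pos (E : normedModType R) (f : E -> R) :
  (forall k, Ck k setT f) -> open [set x | 0 < f x].
Proof.
move=> Cf; apply: (@open_comp _ _ f [set y | 0 < y]); last exact: open_gt.
by move=> x _; exact: (Cf 0%N x).
Qed.

(** Left translation by the group moves a single chart near the identity to
    every point. *)
Lemma bundle_submanifold : cx_submanifold 3 bundle.
Proof.
move=> p [_ [q0 SUq0 <-] <-].
have [r0 [SUr0 rq qr]] := SU11_inv SUq0.
(* Near [q0], the chart is [q0 *m su (x +i* y) c] with [x > 0] eliminated by
   [x ^+ 2 = 1 + |c| ^+ 2 - y ^+ 2]; its inverse reads [y] and [c] off the
   linear map [K]. *)
pose K x := r0 *m pull (cplxmx x).
pose W := [set x | 0 < complex.Re (ent00 (K x))].
pose y_ (u : 'rV[R]_3) := u 0 0.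
pose ga (u : 'rV[R]_3) : C := u 0 1 +i* u 0 (inord 2).
pose D u := 1 + sqn (ga u) - y_ u ^+ 2.
pose al u : C := Num.sqrt (D u) +i* y_ u.
pose U := [set u | 0 < D u].
pose phi u := realmx (orbit_map (q0 *m su (al u) (ga u))).
have CK : mxsmooth setT K.
  apply: mxsmoothM; [exact: openT|exact: (mxsmooth_cst openT)|].
  apply: mxsmooth_pull; first exact: openT.
  by apply: mxsmooth_cplxmx; exact: openT.
have CKe := csmooth_ent00 CK; have CKc := csmooth_ent10 CK.
have Cga V : open V -> csmooth V ga.
  by move=> Vo k; split; exact: Ck_coord.
have CD V : open V -> forall k, Ck k V D.
  move=> Vo k.
  have Cy : Ck k V y_ by exact: Ck_coord.
  apply: (Ck_ext Vo _ (CkD Vo (CkD Vo (Ck_cst Vo k (1 : R)) (csmooth_sqn Vo (Cga V Vo) k))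
    (CkN Vo (CkM Vo Cy Cy)))) => u _ /=.
  by rewrite /D expr2.
have Uo : open U by apply: open_pos => k; apply: CD; exact: openT.
have SUag u : U u -> SU (su (al u) (ga u)).
  move=> Du; apply/SU11_su/unorm1P; rewrite {1}/sqn /= sqr_sqrtr; last exact: ltW.
  by rewrite /D subrK.
exists W, U, phi; split.
- by apply: open_pos => k; have [] := CKe k.
- by rewrite /W /= /K realmxK pull_orbit rq -su1 ent00_su ltr01.
- exact: Uo.
pose row x : 'rV[R]_3 := \row_(j < 3)
  nth 0 [:: complex.Im (ent00 (K x)); complex.Re (ent10 (K x)); complex.Im (ent10 (K x))] j.
have y_row x : y_ (row x) = complex.Im (ent00 (K x)) by rewrite /y_ mxE.
have ga_row x : ga (row x) = ent10 (K x).
  by apply: complex_eqP; rewrite /ga /= !mxE ?inordK.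
exists row; split.
- move=> u Uu; exists U, phi; split=> //.
  apply: smooth_open_realmx => //; apply: mxsmooth_orbit => //.
  apply: mxsmoothM => //; first exact: mxsmooth_cst.
  apply: mxsmooth_su => //; last exact: Cga.
  move=> k; split; last exact: Ck_coord.
  by apply: Ck_sqrt => //; exact: CD.
- move=> x _; exists setT, row; split=> //.
  apply: smooth_open_rowmx; first exact: openT.
  move=> j k; have [K1 K2] := CKe k; have [K3 K4] := CKc k.
  case: j => [[|[|[|]]] //] jlt.
  + by apply: (Ck_ext openT _ K2) => x' _; rewrite mxE.
  + by apply: (Ck_ext openT _ K3) => x' _; rewrite mxE.
  + by apply: (Ck_ext openT _ K4) => x' _; rewrite mxE.
- move=> u Uu.
  have Kphi : K (phi u) = su (al u) (ga u).
    by rewrite /K /phi realmxK pull_orbit mulmxA rq mul1mx.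
  split.
    split; last by rewrite /W /= Kphi ent00_su /= sqrtr_gt0.
    exists (orbit_map (q0 *m su (al u) (ga u))) => //.
    exists (q0 *m su (al u) (ga u)) => //; apply: SU11_mul => //; exact: SUag.
  apply/rowP => j; rewrite mxE Kphi ent00_su ent10_su.
  case: j => [[|[|[|]]] //] jlt /=; congr (u _ _); apply: val_inj => //=.
  by rewrite inordK.
- move=> x [[_ [q SUq <-] xE] Wx].
  have Kx : K x = r0 *m q by rewrite /K -xE realmxK pull_orbit.
  have /SU11P[e [c [rqE ec]]] : SU (r0 *m q) by exact: SU11_mul.
  have De : D (row x) = complex.Re e ^+ 2.
    rewrite /D ga_row y_row Kx rqE ent00_su ent10_su.
    by move/unorm1P: ec => <-; rewrite /sqn addrK.
  have e0 : 0 < complex.Re e by move: Wx; rewrite /W /= Kx rqE ent00_su.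
  have alE : al (row x) = e.
    rewrite /al De y_row Kx rqE ent00_su sqrtr_sqr gtr0_norm //.
    by case: (e).
  split; first by rewrite /U /= De exprn_gt0.
  rewrite /phi alE ga_row Kx rqE ent10_su -rqE mulmxA qr mul1mx.
  exact: xE.
Qed.

Lemma bundle_tangent g : bundle g ->
  tangent_space bundle g = [set g *m M | M in amp_su11 Y].
Proof.
move=> [q SUq <-]; apply/seteqP; split=> [v [c [Cc c0 cP dc]]|_ [_ [al [ga [al0 ->]]] <-]].
  have dp : has_velocity (fun t => pull (c t)) 0 (pull v).
    by apply: velocity_compress; apply: velocityMl.
  have pP : \forall t \near (0 : R), SU (pull (c t)).
    by apply: filterS cP => t [q' SUq' <-]; rewrite pull_orbit.
  have [al [ga [al0 vE]]] := SU11_velocity pP dp.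
  rewrite c0 pull_orbit in vE.
  exists (amp (su al ga)); first by exists al, ga.
  rewrite orbit_map_amp -vE; apply/esym/(velocity_uniq dc).
  apply: velocity_near (velocity_orbit dp).
  by apply: filterS cP => t [q' SUq' <-]; congr orbit_map; exact: pull_orbit.
have [Cs SUs s0 ds] := SU11_curveP (complex.Im al) ga.
exists (fun t => orbit_map (q *m SU11_curve (complex.Im al) ga t)); split.
- apply: smooth_open_realmx; first exact: openT.
  apply: mxsmooth_orbit; first exact: openT.
  by apply: mxsmoothM; [exact: openT|exact: (mxsmooth_cst openT)|exact: Cs].
- by rewrite s0 mulmx1.
- apply: near0W => t; exists (q *m SU11_curve (complex.Im al) ga t) => //.
  by apply: SU11_mul => //; exact: SUs.
- rewrite orbit_map_amp.
  have -> : al = 0 +i* complex.Im al by apply: complex_eqP.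
  exact: velocity_orbit (velocityMl q ds).
Qed.

Lemma bundle_connected : cx_connected bundle.
Proof.
apply: SU11_image_connected => gam Cg.
by apply: mxsmooth_orbit => //; exact: openT.
Qed.

Lemma translate_prD (g : mat) : [set a *m x | x in prD g] = prD (a *m g).
Proof.
apply/seteqP; split=> [_ [_ [h Hh <-] <-]|_ [h Hh <-]].
  by exists h => //; rewrite mulmxA.
by exists (g *m h); [exists h|rewrite mulmxA].
Qed.

Lemma prD_bundle : @prD R n m @` bundle = translate a disc.
Proof.
apply/seteqP; split=> [_ [_ [q SUq <-] <-]|_ [_ [_ [q SUq <-] <-] <-]].
  exists (prD (emb q)); last by rewrite translate_prD.
  by exists (emb q) => //; exists q.
exists (orbit_map q); first by exists q.
by rewrite translate_prD.
Qed.

Lemma bundle_integral :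
  [/\ integral_manifold (amp_su11 Y) bundle, cx_connected bundle &
      @prD R n m @` bundle = translate a disc].
Proof.
split; [split|exact: bundle_connected|exact: prD_bundle].
- by move=> _ [q SUq <-]; exact: orbit_map_Unm.
- by exists 3%N; exact: bundle_submanifold.
- exact: bundle_tangent.
Qed.

Definition circle_emb (u : 'M[C]_1) : mat := emb (su (u 0 0) 0).

Lemma Un1P (u : 'M[C]_1) : Un u <-> u 0 0 * conj (u 0 0) = 1.
Proof.
rewrite {1}(mx11_scalar u); split.
  by move=> /unitaryP; rewrite adj_scalar -scalar_mxM => /matrixP/(_ 0 0); rewrite !mxE eqxx.
by move=> e; apply/unitaryP; rewrite adj_scalar -scalar_mxM e.
Qed.

Lemma circle_embM u v : circle_emb (u *m v) = circle_emb u *m circle_emb v.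
Proof.
by rewrite /circle_emb (embM YY) suM !mxE big_ord1 !mulr0 mul0r !addr0.
Qed.

Lemma circle_emb_UxU : circle_emb @` @Un R 1 `<=` H.
Proof. by move=> _ [u /Un1P uu <-]; exact: (emb_diag YY). Qed.

Lemma circle_emb_diffeo : cx_diffeo (@Un R 1) (circle_emb @` @Un R 1) circle_emb.
Proof.
exists (fun x => realmx ((ent00 (compress Y i0 (cplxmx x)))%:M : 'M[C]_1)).
have inv u : (ent00 (compress Y i0 (circle_emb u)))%:M = u.
  by rewrite /circle_emb (compress_emb YY) ent00_su -mx11_scalar.
split.
- rewrite /circle_emb; apply: smooth_cx_imageT.
  apply: mxsmooth_emb; first exact: openT.
  apply: mxsmooth_su; [exact: openT| |exact: (csmooth_cst openT)].
  exact: (mxsmooth_cplxmx openT 0 0).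
- apply: smooth_cx_imageT; apply: mxsmooth_scalar; first exact: openT.
  apply: csmooth_ent00; apply: mxsmooth_compress; first exact: openT.
  exact: (mxsmooth_cplxmx openT).
- move=> _ [u Uu <-]; rewrite !realmxK inv; split=> //.
  by exists (circle_emb u) => //; exists u.
- move=> _ [_ [u Uu <-] <-]; by rewrite !realmxK inv; split.
Qed.

(** Two points of the bundle in the same fibre differ by an element of the
    image of SU(1,1) that is block diagonal, i.e. of the circle. *)
Lemma bundle_reduction g h : bundle g -> H h ->
  (bundle (g *m h) <-> (circle_emb @` @Un R 1) h).
Proof.
move=> [q SUq <-] Hh; split=> [[q' SUq' e]|[u /Un1P uu <-]]; last first.
  exists (q *m su (u 0 0) 0); last exact: orbit_mapM.
  by apply: SU11_mul => //; exact: SU11_diag.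
have [r [SUr rq qr]] := SU11_inv SUq.
have hE : h = emb (r *m q').
  have := e; rewrite /orbit_map -mulmxA => /(cancel_unit a_unit) e'.
  by rewrite -(embM YY) e' mulmxA (embM YY) rq emb1 mul1mx.
have SUrq : SU (r *m q') by exact: SU11_mul.
have Hrq : H (emb (r *m q')) by rewrite -hE.
have [u ue uu] := emb_H_diag YY i0 SUrq Hrq.
exists (u%:M); first by apply/Un1P; rewrite mxE eqxx mulr1n.
by rewrite /circle_emb mxE eqxx mulr1n -ue hE.
Qed.

Lemma bundle_sub : bundle `<=` preD (translate a disc).
Proof.
move=> g Pg; split; first by case: Pg => q SUq <-; exact: orbit_map_Unm.
by rewrite /= -prD_bundle; exists g.
Qed.

(** The positive representative is invariant under the fibre group, so the
    same formula gives a section over the whole surface. *)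
Lemma bundle_sections s : translate a disc s -> exists W (sigma : set mat -> mat),
  [/\ @D_open R n m W, W s,
      smooth_from_D (translate a disc `&` W) (fun x => realmx (sigma x)) &
      forall x, (translate a disc `&` W) x -> bundle (sigma x) /\ prD (sigma x) = x].
Proof.
rewrite -prD_bundle => Ss.
pose Sig (g : mat) := orbit_map (polarD Y i0 (invmx a *m g)).
exists (@Dnm R n m), (fun x => Sig (coset_rep x)); split.
- exact: D_open_Dnm.
- case: Ss => g [q SUq <-] <-; exists (orbit_map q) => //; exact: orbit_map_Unm.
- apply: (@smooth_from_D_rep _ _ _ _ _ (fun g => realmx (Sig g))) => [g h _ Hh|].
    by rewrite /Sig mulmxA (polarDH _ _ _ Hh).
  apply: smooth_open_realmx; first exact: openT.
  apply: mxsmooth_orbit; first exact: openT.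
  apply: mxsmooth_polarD; first exact: openT.
  apply: mxsmoothM; [exact: openT|exact: (mxsmooth_cst openT)|].
  by apply: mxsmooth_cplxmx; exact: openT.
- move=> x [[g [q SUq <-] <-] _]; have [h Hh ->] := coset_repP (orbit_map q).
  have [u uu e] := polarD_emb YY i0 SUq Hh.
  have -> : Sig (orbit_map q *m h) = orbit_map (q *m su u 0).
    by rewrite /Sig /orbit_map -[in LHS](mulmxA a) (mulKmx a_unit) e.
  split; first by exists (q *m su u 0) => //; apply: SU11_mul => //; exact: SU11_diag.
  by rewrite orbit_mapM; apply: prD_mul; exact: (emb_diag YY).
Qed.

Lemma bundle_U1 : U1_subbundle circle_emb (translate a disc) bundle.
Proof.
split.
- split; [exact: circle_emb_UxU|by move=> u v _ _; exact: circle_embM|].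
  exact: circle_emb_diffeo.
- exact: bundle_sub.
- by exists 3%N; exact: bundle_submanifold.
- by move=> g h; exact: bundle_reduction.
- exact: bundle_sections.
Qed.

Lemma orbit_bundle_map : SU11_bundle_map orbit_map emb.
Proof.
split.
- split; last by move=> _ [q SUq <-]; exact: orbit_map_Unm.
  apply: cx_smoothT; apply: mxsmooth_orbit; first exact: openT.
  by apply: mxsmooth_cplxmx; exact: openT.
- split; last by move=> _ [k /SU1U1P[u -> uu] <-]; exact: (emb_diag YY).
  apply: cx_smoothT; apply: mxsmooth_emb; first exact: openT.
  by apply: mxsmooth_cplxmx; exact: openT.
- by move=> k l _ _; rewrite (embM YY).
- by move=> q k _ _; exact: orbit_mapM.
Qed.

(** Both vectors are left translates of the same element of su(1,1), and of
    its image under [amp]. *)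
Lemma tangent_map_orbit q v w : tangent_map SU orbit_map q v w ->
  exists al ga, [/\ complex.Re al = 0, v = q *m su al ga &
                    w = orbit_map q *m amp (su al ga)].
Proof.
move=> [c [[_ c0 cSU dc] dw]].
have [al [ga [al0 vE]]] := SU11_velocity cSU dc.
exists al, ga; rewrite c0 in vE; split=> //.
by rewrite orbit_map_amp -vE; apply: (velocity_uniq dw); exact: velocity_orbit.
Qed.

Lemma amp_inj : injective amp.
Proof. by apply: (can_inj (g := compress Y i0)) => M; exact: compress_amp. Qed.

Lemma orbit_immersion : immersion SU orbit_map.
Proof.
split; first by have [[]] := orbit_bundle_map.
move=> q v SUq /tangent_map_orbit[al [ga [_ -> e]]].
have ug : orbit_map q \in unitmx by have [] := orbit_map_Unm SUq.
have -> : su al ga = 0; last exact: mulmx0.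
apply: amp_inj; rewrite amp0; apply: (cancel_unit ug).
by rewrite -e mulmx0.
Qed.

Lemma S21P (z : 'M[C]_(2, 1)) : @S21 R z <-> unorm (z ord0 ord0) (z ord_max ord0) = 1.
Proof.
rewrite /S21 /= -!add_Re2_Im2 /unorm -!sqnE -/(sqn _) -/(sqn _); split=> e.
  by rewrite -[RHS]opprK -e opprD opprK.
by rewrite -e opprB addrC.
Qed.

(** The first column of the corresponding matrix of SU(1,1). *)
Definition hopf (g : mat) : 'M[C]_(2, 1) := lsubmx (pull g : 'M[C]_(1 + 1, 1 + 1)).

Lemma hopf_orbit al ga :
  hopf (orbit_map (su al ga)) ord0 ord0 = al /\
  hopf (orbit_map (su al ga)) ord_max ord0 = ga.
Proof.
have e0 : ord0 = lshift 1 ord0 :> 'I_(1 + 1) by apply: val_inj.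
have e1 : ord_max = rshift 1 ord0 :> 'I_(1 + 1) by apply: val_inj.
rewrite /hopf pull_orbit !mxE; split.
  by have := ent00_su al ga; rewrite /ent00 !mxE e0.
by have := ent10_su al ga; rewrite /ent10 !mxE e1.
Qed.

Lemma mx21_eq (z w : 'M[C]_(2, 1)) :
  z ord0 ord0 = w ord0 ord0 -> z ord_max ord0 = w ord_max ord0 -> z = w.
Proof.
move=> e0 e1; apply/matrixP => i j; rewrite ord1.
have [->|i0'] := eqVneq i ord0; first exact: e0.
suff -> : i = ord_max by exact: e1.
by apply: val_inj; case: i i0' => [[|[|]]].
Qed.

(** An element of SU(1,1) is determined by its first column, which ranges
    over S^{2,1}, and right multiplication by [su u 0] multiplies that
    column by [u]. *)
Lemma bundle_Hopf : isomorphic_to_Hopf circle_emb bundle.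
Proof.
pose K (z : 'M[C]_(2, 1)) := orbit_map (su (z ord0 ord0) (z ord_max ord0)).
have hopfK z : hopf (K z) = z.
  by have [e0 e1] := hopf_orbit (z ord0 ord0) (z ord_max ord0); exact: mx21_eq.
have Khopf al ga : K (hopf (orbit_map (su al ga))) = orbit_map (su al ga).
  by rewrite /K; have [-> ->] := hopf_orbit al ga.
exists hopf; split.
  exists (fun x => realmx (K (cplxmx x))); split.
  - apply: smooth_cx_imageT => i j.
    have Cp : mxsmooth setT (fun x : 'M[R]_(n + m, (n + m) + (n + m)) => pull (cplxmx x)).
      by apply: mxsmooth_pull; [exact: openT|apply: mxsmooth_cplxmx; exact: openT].
    by apply: csmooth_ext (Cp i (lshift 1 j)) => x; rewrite /hopf [RHS]mxE.
  - apply: smooth_cx_imageT; apply: mxsmooth_orbit; first exact: openT.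
    by apply: mxsmooth_su; [exact: openT| |]; exact: (mxsmooth_cplxmx openT).
  - move=> _ [_ [q /SU11P[al [ga [-> ag]]] <-] <-]; rewrite !realmxK Khopf; split=> //.
    exists (hopf (orbit_map (su al ga))) => //.
    by apply/S21P; have [-> ->] := hopf_orbit al ga.
  - move=> _ [z /S21P Sz <-]; rewrite !realmxK hopfK; split=> //.
    by exists (K z) => //; exists (su (z ord0 ord0) (z ord_max ord0)) => //; exact/SU11_su.
move=> _ u [q /SU11P[al [ga [-> ag]]] <-] Uu.
rewrite /circle_emb -orbit_mapM suM !mulr0 !addr0.
have [e0 e1] := hopf_orbit al ga.
have [e0' e1'] := hopf_orbit (al * u 0 0) (ga * u 0 0).
by apply: mx21_eq; rewrite ?e0' ?e1' mxE big_ord1 ?e0 ?e1.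
Qed.

(** Since [amp] is a homomorphism compatible with adjoints, the inner
    product is a trace on one copy, taken [n] times. *)
Lemma ip_su11_su al ga al' ga' : complex.Re al = 0 -> complex.Re al' = 0 ->
  ip_unm (amp (su al ga)) (amp (su al' ga')) =
  n%:R * ip_su11 (su al ga) (su al' ga').
Proof.
have e0 : ord0 = lshift 1 ord0 :> 'I_(1 + 1) by apply: val_inj.
have e1 : ord_max = rshift 1 ord0 :> 'I_(1 + 1) by apply: val_inj.
have crdE (x y : C) : [/\ crd1 (su x y) = complex.Re y, crd2 (su x y) = complex.Im y &
    crd3 (su x y) = - complex.Im x].
  rewrite /crd1 /crd2 /crd3 e0 e1 block_mxEdl block_mxEdr !mxE /= !mulr1n.
  by rewrite cImJ.
move=> al0 al0'; have [d1 d2 d3] := crdE al ga; have [d1' d2' d3'] := crdE al' ga'.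
rewrite /ip_su11 d1 d2 d3 d1' d2' d3' /ip_unm amp_adj (ampM YY) (amp_tr YY).
rewrite su_adj suM /su mxtrace_block !mxtrace_scalar !mulr1n.
rewrite !cReImE.
have -> : complex.Re (n%:R : C) = n%:R by rewrite -(rmorph_nat (real_complex R)).
have -> : complex.Im (n%:R : C) = 0 by rewrite -(rmorph_nat (real_complex R)).
by rewrite al0 al0'; field.
Qed.

Lemma orbit_metric q v v' w w' : SU q ->
  tangent_map SU orbit_map q v w -> tangent_map SU orbit_map q v' w' ->
  left_inv_metric (@ip_unm R (n + m)) (orbit_map q) w w' =
  n%:R * left_inv_metric (@ip_su11 R) q v v'.
Proof.
move=> SUq /tangent_map_orbit[al [ga [al0 -> ->]]] /tangent_map_orbit[al' [ga' [al0' -> ->]]].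
have ug : orbit_map q \in unitmx by have [] := orbit_map_Unm SUq.
have uq : q \in unitmx by have [[]] := SUq.
transitivity (ip_unm (amp (su al ga)) (amp (su al' ga'))).
  by congr ip_unm; exact: (mulKmx ug).
rewrite (ip_su11_su _ _ al0 al0'); congr (_ * ip_su11 _ _); exact/esym/(mulKmx uq).
Qed.

End Bundle.

Theorem theorem3p10 (R : realType) (n m : nat) (X : 'M[R[i]]_(m, n))
    (hn : (0 < n)%N) (hm : (0 < m)%N) (hX : Umn X) :
  exists S0 : set (set 'M[R[i]]_(n + m)),
    arises_from (mprime X) 2 S0 /\
    forall a : 'M[R[i]]_(n + m), Unm a ->
      let S := translate a S0 in
      exists (P : set 'M[R[i]]_(n + m)) (kap : 'M[R[i]]_1 -> 'M[R[i]]_(n + m))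
             (f rho : 'M[R[i]]_(1 + 1) -> 'M[R[i]]_(n + m)),
        [/\ induced_by (mprime X) S P,
            U1_subbundle kap S P,
            [/\ SU11_bundle_map f rho, immersion (@SU11 R) f & f @` @SU11 R = P],
            isomorphic_to_Hopf kap P &
            conformal (@ip_su11 R) (@ip_unm R (n + m)) (@SU11 R) f /\
            forall q v w, SU11 q -> tangent_map (@SU11 R) f q v w ->
              left_inv_norm (@ip_unm R (n + m)) (f q) w =
              Num.sqrt n%:R * left_inv_norm (@ip_su11 R) q v].
Proof.
have [r [Y [r0 YY XE]]] := Umn_isometry hn hX.
pose i0 := Ordinal hn.
exists (disc Y); split.
  split; first exact: (disc_complete_totally_geodesic YY i0).
    exists 1%:M => //; exists 1%:M; [exact: SU11_1|exact: emb1].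
  by rewrite XE (mprime_amp Y r0); exact: (D_tangent_disc1 YY i0).
move=> a Ga S.
exists (bundle Y a), (circle_emb Y), (orbit_map Y a), (emb Y); split.
- rewrite /induced_by XE (generated_distribution_amp YY r0).
  exact: (bundle_integral YY i0 Ga).
- exact: (bundle_U1 YY i0 Ga).
- split; [exact: (orbit_bundle_map YY Ga)|exact: (orbit_immersion YY i0 Ga)|reflexivity].
- exact: (bundle_Hopf YY i0 Ga).
- have met := orbit_metric YY Ga.
  split.
    exists (fun=> n%:R) => q SUq; split; first by rewrite ltr0n.
    by move=> v v' w w'; exact: met.
  move=> q v w SUq tvw; rewrite /left_inv_norm (met _ _ _ _ _ SUq tvw tvw).
  by rewrite sqrtrM // ler0n.
Qed.
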